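(* Let $k\ge1$, $d,n_1,\dots,n_k\ge1$, let $\mathcal{S}_w\subset\mathbb{R}^d$ and $\mathcal{S}_{v_\ell}\subset\mathbb{R}^{n_\ell}$ ($\ell=1,\dots,k$) be compact convex sets, $\mathcal{S}_v:=\mathcal{S}_{v_1}\times\dots\times\mathcal{S}_{v_k}$ with elements $v=(v_1,\dots,v_k)$, let $\psi:\mathcal{S}_w\times\mathcal{S}_v\to\mathbb{R}$ be continuous, and let $\alpha_\ell:\mathbb{R}^d\to\mathbb{R}^d$, $\beta_\ell:\mathbb{R}^{n_\ell}\to\mathbb{R}^{n_\ell}$ be continuous. Let $G_\ell\in\mathbb{R}^{n_\ell\times d}$, $g_\ell\in\mathbb{R}^d$, $h_\ell\in\mathbb{R}^{n_\ell}$ ($\ell=1,\dots,k$) be mutually independent with i.i.d. $\mathcal{N}(0,1)$ entries, and define $$\Phi(G):=\min_{w\in\mathcal{S}_w}\max_{v\in\mathcal{S}_v}\sum_{\ell=1}^k\beta_\ell(v_\ell)^TG_\ell\,\alpha_\ell(w)+\psi(w,v),$$ $$\phi(g,h):=\min_{w\in\mathcal{S}_w}\max_{v\in\mathcal{S}_v}\sum_{\ell=1}^k\Big[\|\beta_\ell(v_\ell)\|_2\,g_\ell^T\alpha_\ell(w)+\|\alpha_\ell(w)\|_2\,h_\ell^T\beta_\ell(v_\ell)\Big]+\psi(w,v).$$ Then for every $t\in\mathbb{R}$, $$\mathbb{P}(\Phi(G)<t)\le 2^k\,\mathbb{P}(\phi(g,h)<t).$$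
   Context: $G=(G_1,\dots,G_k)$, $g=(g_1,\dots,g_k)$, $h=(h_1,\dots,h_k)$. Norms are Euclidean. *)

(* Defs.v *)
From HB Require Import structures.
From mathcomp Require Import all_boot all_order all_algebra.
From mathcomp Require Import all_classical all_reals all_analysis.
Set Implicit Arguments. Unset Strict Implicit. Unset Printing Implicit Defensive.
Import Order.TTheory GRing.Theory Num.Theory.
Import numFieldNormedType.Exports.
Local Open Scope classical_set_scope.
Local Open Scope ring_scope.

Section Defs.
Variable R : realType.

Definition enorm (m : nat) (x : 'rV[R]_m) : R :=
  Num.sqrt (\sum_(i < m) x ord0 i ^+ 2).

Definition dotv (m : nat) (x y : 'rV[R]_m) : R := (x *m y^T) ord0 ord0.

Definition bilin (n d : nat) (b : 'rV[R]_n) (M : 'M[R]_(n, d)) (a : 'rV[R]_d) : R :=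
  (b *m M *m a^T) ord0 ord0.

(* min_{w in Sw} max_{v in Sv} F w v, written as inf/sup (they are attained
   under the compactness/continuity hypotheses of the theorem). *)
Definition minmax (A B : Type) (Sw : set A) (Sv : set B) (F : A -> B -> R) : R :=
  inf [set sup [set F w v | v in Sv] | w in Sw].

Definition iid_std_normal (dT : measure_display) (T : measurableType dT)
  (P : probability T R) (I : finType) (X : I -> T -> R) : Prop :=
  (forall i, measurable_fun setT (X i)) /\
  (forall B : I -> set R, (forall i, measurable (B i)) ->
     P (\bigcap_(i in [set: I]) (X i @^-1` B i)) =
     (\prod_(i : I) normal_prob 0 1 (B i))%E).

(* Index type of all scalar Gaussian entries: entries of the G_l, of the g_l,
   and of the h_l. *)
Definition gidx (k d : nat) (n : 'I_k -> nat) : finType :=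
  Datatypes.sum (Datatypes.sum {l : 'I_k & prod 'I_(n l) 'I_d} {l : 'I_k & 'I_d})
    {l : 'I_k & 'I_(n l)}.

Definition gentries (dT : measure_display) (T : measurableType dT)
  (k d : nat) (n : 'I_k -> nat)
  (G : forall l : 'I_k, T -> 'M[R]_(n l, d))
  (g : 'I_k -> T -> 'rV[R]_d)
  (h : forall l : 'I_k, T -> 'rV[R]_(n l)) (e : gidx d n) : T -> R :=
  match e with
  | inl (inl (existT l ij)) => fun om => G l om ij.1 ij.2
  | inl (inr (existT l j)) => fun om => g l om ord0 j
  | inr (existT l i) => fun om => h l om ord0 i
  end.

End Defs.

(* Main.v *)
Require Import Defs.
From HB Require Import structures.
From mathcomp Require Import all_boot all_order all_algebra.
From mathcomp Require Import all_classical all_reals all_analysis.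
From mathcomp Require Import measurable_realfun ring lra.
Import Order.TTheory GRing.Theory Num.Theory.
Import numFieldNormedType.Exports.
Local Open Scope classical_set_scope.
Local Open Scope ring_scope.

Set Implicit Arguments.
Unset Strict Implicit.
Unset Printing Implicit Defensive.

(** Gordon's comparison, proved by a Lindeberg-type exchange.

    Let [Y w v = sum_l b_l^T G_l a_l + gam_l |a_l| |b_l|], with independent extra standard
    normals [gam_l], and [X w v = sum_l |b_l| g_l^T a_l + |a_l| h_l^T b_l].  The difference
    [cov Y - cov X] is [sum_l (|a_l||a'_l| - <a_l,a'_l>)(|b_l||b'_l| - <b_l,b'_l>)], which is
    nonnegative and vanishes when [w = w'].  On finite index sets the event
    "some row [w] stays below the threshold" is approximated by
    [F z = 1 - prod_w (1 - prod_v chi (z w v))] with [chi] a steep decreasing logistic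
    function; the mixed second derivatives of [F] across different rows are nonpositive.
    A second-order Taylor expansion gives, for small increments,
    [E F (z + e Y) <= E F (z + e X) + O(e^3)].  By stability of the normal law, [X] can be
    turned into [Y] by [N] exchanges of increments of size [e = N^(-1/2)], at a total cost
    [O(N^(-1/2))], hence [E F Y <= E F X].  Since [gam <= 0] has probability at least [2^-k]
    and is independent of [G], this yields the factor [2^k].  The general case follows by
    exhausting the two compact sets with countable dense sequences. *)

(** * Families of independent standard normal variables *)

(** Exchanging small increments stands in for Gaussian integration by parts: the probabilistic input
    is stability of the normal law, its sign symmetry, which kills odd moments, and a finite third
    moment. The bilinear process alone has variance [sum_l |a_l|^2 |b_l|^2], half that of [X], while
    the comparison requires equal variances and equal covariances inside a row. The terms in [gam]
    repair this, and getting rid of them again by restricting to [gam <= 0] is the only source of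
    the factor. The given probability space need not carry [gam] or independent copies of the
    entries, so the argument moves to product spaces; this is harmless because every integral
    involved depends only on the joint law. Smoothing compares a threshold [s] with a strictly
    larger [t]. The gap is recovered at the end because a strict inequality for the min-max is an
    increasing union of events that leave a positive margin. *)

Section iid_law.
Context {R : realType} {I : finType}.

(** The function space [I -> R] is given no sigma-algebra here; measurability of [f] is tested
    against all families of measurable coordinates, in particular the coordinates of a tuple. *)
Definition coord_measurable (f : (I -> R) -> \bar R) :=
  forall d (T : measurableType d) (Z : I -> T -> R),
    (forall i, measurable_fun setT (Z i)) -> measurable_fun setT (fun w => f (Z^~ w)).

Let tup (z : I -> R) : #|I|.-tuple R := [tuple z (enum_val i) | i < #|I|].

Let boxes : set (set (#|I|.-tuple R)) :=
  [set A | exists2 B : 'I_#|I| -> set R, (forall i, measurable (B i)) &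
     A = \bigcap_(i in [set: 'I_#|I|]) (@tnth _ R ^~ i @^-1` B i)].

Let boxes_measurable : boxes `<=` measurable.
Proof.
move=> _ [B mB ->]; apply: fin_bigcap_measurable => // i _.
by rewrite -[X in measurable X]setTI; exact: measurable_tnth.
Qed.

Let boxes_setI : setI_closed boxes.
Proof.
move=> _ _ [B mB ->] [C mC ->]; exists (fun i => B i `&` C i).
  by move=> i; exact: measurableI.
by rewrite -bigcapI; apply: eq_bigcapr => i _; rewrite preimage_setI.
Qed.

Let measurable_boxes (A : set (#|I|.-tuple R)) : measurable A -> <<s boxes >> A.
Proof.
apply: smallest_sub; first exact: smallest_sigma_algebra.
move=> X; rewrite -bigcup_seq => -[i /= _ [C mC <-]].
(* A generator of the tuple sigma-algebra constrains one coordinate: it is the box whose other sides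
   are full. *)
apply: sub_sigma_algebra; exists (fun j => if j == i then C else setT).
  by move=> j; case: ifP.
rewrite setTI; apply/seteqP; split => [t /= Ct j _|t /= /(_ i Logic.I)] /=.
  by case: eqP => // ->.
by rewrite eqxx.
Qed.

(* By the pi-lambda theorem, the product rule on boxes determines the law. *)
Lemma iid_std_normal_integral_eq d1 (T1 : measurableType d1) (P1 : probability T1 R)
    (X1 : I -> T1 -> R) d2 (T2 : measurableType d2) (P2 : probability T2 R)
    (X2 : I -> T2 -> R) (f : (I -> R) -> \bar R) :
  iid_std_normal P1 X1 -> iid_std_normal P2 X2 ->
  coord_measurable f -> (forall z, 0 <= f z)%E ->
  (\int[P1]_w f (X1^~ w) = \int[P2]_w f (X2^~ w))%E.
Proof.
move=> [mX1 iid1] [mX2 iid2] mf f0.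
have mtup d (T : measurableType d) (X : I -> T -> R) :
    (forall i, measurable_fun setT (X i)) -> measurable_fun setT (fun w => tup (X^~ w)).
  move=> mX; apply/measurable_fun_tnthP => i.
  by rewrite (_ : _ \o _ = X (enum_val i)) //; apply/funext => w /=; rewrite tnth_mktuple.
pose ft (t : #|I|.-tuple R) := f (fun i => tnth t (enum_rank i)).
have mft : measurable_fun setT ft by apply: mf => i; exact: measurable_tnth.
have ftE z : ft (tup z) = f z.
  by congr f; apply/funext => i; rewrite tnth_mktuple enum_rankK.
have push d (T : measurableType d) (P : probability T R) (X : I -> T -> R)
    (mX : forall i, measurable_fun setT (X i)) :
    (\int[P]_w f (X^~ w) = \int[pushforward P (fun w => tup (X^~ w))]_t ft t)%E.
  rewrite ge0_integral_pushforward//; [| exact: mtup | by move=> t _; exact: f0].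
  by rewrite preimage_setT; apply: eq_integral => w _ /=; rewrite ftE.
rewrite (push _ _ _ _ mX1) (push _ _ _ _ mX2).
have mt1 := mtup _ _ _ mX1; have mt2 := mtup _ _ _ mX2.
have tupE d (T : measurableType d) (X : I -> T -> R) (B : 'I_#|I| -> set R) :
    (fun w => tup (X^~ w)) @^-1` (\bigcap_(i in [set: 'I_#|I|]) (@tnth _ R ^~ i @^-1` B i))
    = \bigcap_(i in [set: I]) (X i @^-1` B (enum_rank i)).
  apply/seteqP; split => w /= Bw i _ /=.
    by have := Bw (enum_rank i) Logic.I; rewrite /= tnth_mktuple enum_rankK.
  by have := Bw (enum_val i) Logic.I; rewrite /= tnth_mktuple enum_valK.
apply: eq_measure_integral => A mA _.
apply: (measure_unique boxes (fun=> setT)) => //.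
- apply/seteqP; split; first exact: measurable_boxes.
  by apply: smallest_sub => //; exact: sigma_algebra_measurable.
- move=> _; exists (fun=> setT) => //.
  by apply/esym; rewrite -subTset => t _ i _.
- by rewrite bigcup_const.
- by move=> _ [B mB ->]; rewrite /= /pushforward !tupE iid1 ?iid2.
- by move=> _; rewrite /= /pushforward preimage_setT probability_setT ltry.
Qed.

End iid_law.

(** * Densities and affine change of variable *)

Section integral_density.
Context d (T : measurableType d) {R : realType}.
Variables (mu nu : {measure set T -> \bar R}) (p : T -> R).
Hypothesis p0 : forall x, 0 <= p x.
Hypothesis mp : measurable_fun setT p.
Hypothesis nuE : forall A, measurable A -> nu A = (\int[mu]_(x in A) (p x)%:E)%E.

Import HBNNSimple.

Let integral_density_nnsfun (f : {nnsfun T >-> R}) :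
  (\int[nu]_x (f x)%:E = \int[mu]_x ((f x)%:E * (p x)%:E))%E.
Proof.
under [LHS]eq_integral do rewrite fimfunE -fsumEFin//.
rewrite [LHS]ge0_integral_fsum//; last 2 first.
  - by move=> r; exact/measurable_EFinP/measurableT_comp.
  - by move=> n x _; rewrite EFinM nnfun_muleindic_ge0.
under [RHS]eq_integral.
  move=> x _; rewrite fimfunE -fsumEFin// ge0_mule_fsuml; last first.
    by move=> r; exact: (nnfun_muleindic_ge0 f r x).
  over.
rewrite [RHS]ge0_integral_fsum//; last 2 first.
  - move=> r; apply: emeasurable_funM; last exact/measurable_EFinP.
    exact/measurable_EFinP/measurableT_comp.
  - by move=> r x _; apply: mule_ge0; [exact: (nnfun_muleindic_ge0 f r x)|rewrite lee_fin].
apply: eq_fsbigr => r _.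
have mr : measurable (f @^-1` [set r]) by [].
under [RHS]eq_integral do rewrite EFinM -muleA.
rewrite integralZl_indic_nnsfun//= integral_indic// setIT nuE//.
have [r0|r0] := leP 0 r; last first.
  rewrite preimage_nnfun0// integral_set0 mule0.
  by rewrite integral0_eq// => x _; rewrite indic0 mul0e mule0.
rewrite ge0_integralZl//; last 2 first.
  - apply: emeasurable_funM; last exact/measurable_EFinP.
    exact/measurable_EFinP/measurable_indic.
  - by move=> x _; rewrite mule_ge0 ?lee_fin.
congr (_ * _)%E; rewrite integral_mkcond; apply: eq_integral => x _.
by rewrite epatch_indic /= muleC.
Qed.

(** Linearity settles simple functions; monotone convergence on both sides does the rest, since
    multiplying by [p >= 0] keeps the approximations increasing. *)
Lemma ge0_integral_density (f : T -> \bar R) : measurable_fun setT f ->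
  (forall x, 0 <= f x)%E -> (\int[nu]_x f x = \int[mu]_x (f x * (p x)%:E))%E.
Proof.
move=> mf f0; pose f_ := nnsfun_approx measurableT mf.
have f_cvg x : (f_ n x)%:E @[n --> \oo] --> f x.
  by apply: cvg_nnsfun_approx.
transitivity (limn (fun n => \int[nu]_x (f_ n x)%:E))%E.
  rewrite -monotone_convergence//=.
  - by apply: eq_integral => x _; apply/esym/cvg_lim => //.
  - by move=> n; exact/measurable_EFinP/measurable_funTS.
  - by move=> n ? _; rewrite lee_fin.
  - by move=> ? _ ? ? mn; rewrite lee_fin; exact/lefP/nd_nnsfun_approx.
transitivity (limn (fun n => \int[mu]_x ((f_ n x)%:E * (p x)%:E)))%E.
  by apply: congr_lim; apply/funext => n; exact: integral_density_nnsfun.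
rewrite -monotone_convergence//=.
- apply: eq_integral => x _; apply/cvg_lim => //.
  by apply: cvgeZr => //.
- move=> n; apply: emeasurable_funM; exact/measurable_EFinP.
- by move=> n x _; rewrite mule_ge0 ?lee_fin.
- move=> x _ m n mn; apply: lee_wpmul2r; rewrite lee_fin//.
  exact/lefP/nd_nnsfun_approx.
Qed.

End integral_density.

Section lebesgue_affine.
Context {R : realType}.
Local Notation mu := (@lebesgue_measure R).

(** The image of Lebesgue measure under [x |-> a x + c], scaled by [a], has the right value on
    half-open intervals, hence is Lebesgue measure. *)
Lemma ge0_integral_affine (a c : R) (f : R -> \bar R) : 0 < a ->
  measurable_fun setT f -> (forall x, 0 <= f x)%E ->
  (\int[mu]_x f x = a%:E * \int[mu]_x f (a * x + c)%R)%E.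
Proof.
move=> a0 mf f0.
have a0' : (0 <= a)%R by exact: ltW.
pose T (x : R) : measurableTypeR R := a * x + c.
have mT : measurable_fun setT T.
  by apply: measurable_funD => //; apply: measurable_funM.
rewrite (eq_measure_integral (mscale (NngNum a0') (pushforward mu T))); last first.
  move=> A mA _; apply: lebesgue_measure_unique => //= _ [[u v]] _ <-.
  rewrite /mscale /= /pushforward.
  have -> : T @^-1` `]u, v]%classic = `](u - c) / a, (v - c) / a]%classic.
    apply/seteqP; split => x /=; rewrite !in_itv/= ltr_pdivrMr// ler_pdivlMr//;
      rewrite /T; by rewrite ltrBlDr lerBrDr mulrC.
  rewrite !lebesgue_measure_itv/= !lte_fin ltr_pM2r ?invr_gt0// ltrD2r.
  case: ifPn => _; last by rewrite mule0.
  by rewrite -!EFinD -EFinM; congr EFin; field; rewrite gt_eqF.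
rewrite ge0_integral_mscale//= ge0_integral_pushforward//.
Qed.

End lebesgue_affine.

(** * Product spaces and existence of independent normals *)

Section prod_prob.
Context d1 d2 (T1 : measurableType d1) (T2 : measurableType d2) {R : realType}.
Variables (P1 : probability T1 R) (P2 : probability T2 R).

Definition prod_prob : probability (T1 * T2)%type R := (P1 \x P2)%E.

Lemma prod_probE A B : measurable A -> measurable B ->
  prod_prob (A `*` B) = (P1 A * P2 B)%E.
Proof. exact: product_measure1E. Qed.

Lemma ge0_integral_prod_prob (f : T1 * T2 -> \bar R) : measurable_fun setT f ->
  (forall z, 0 <= f z)%E ->
  (\int[prod_prob]_z f z = \int[P1]_x \int[P2]_y f (x, y))%E.
Proof. by move=> mf f0; rewrite fubini_tonelli1. Qed.

Lemma ge0_integral_swap (f : T1 * T2 -> \bar R) : measurable_fun setT f ->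
  (forall z, 0 <= f z)%E ->
  (\int[P1]_x \int[P2]_y f (x, y) = \int[P2]_y \int[P1]_x f (x, y))%E.
Proof. by move=> mf f0; rewrite -fubini_tonelli. Qed.

Lemma measurable_integral_snd (f : T1 * T2 -> \bar R) : measurable_fun setT f ->
  (forall z, 0 <= f z)%E -> measurable_fun setT (fun x => \int[P2]_y f (x, y))%E.
Proof. by move=> mf f0; exact: (measurable_fun_fubini_tonelli_F f). Qed.

End prod_prob.

Lemma emeasurable_prod d (T : measurableType d) (R : realType) (I : Type) (s : seq I)
    (f : I -> T -> \bar R) : (forall i, measurable_fun setT (f i)) ->
  measurable_fun setT (fun x => \prod_(i <- s) f i x)%E.
Proof.
move=> mf; elim: s => [|i s IH].
  by under eq_fun do rewrite big_nil; exact: measurable_cst.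
by under eq_fun do rewrite big_cons; exact: emeasurable_funM.
Qed.

Section iid_product.
Context {R : realType}.
Local Notation nu := (normal_prob (0 : R) 1).

(** Functional form of being i.i.d. standard normal. Unlike the rule on boxes, it can be integrated
    factor by factor with Tonelli, as the construction and the rotation below require. *)
Definition product_rule d (T : measurableType d) (P : probability T R)
    (I : finType) (X : I -> T -> R) :=
  forall f : I -> R -> \bar R,
    (forall i, measurable_fun setT (f i)) -> (forall i x, 0 <= f i x)%E ->
    (\int[P]_w \prod_i f i (X i w) = \prod_i \int[nu]_x f i x)%E.

Lemma product_rule_iid d (T : measurableType d) (P : probability T R)
    (I : finType) (X : I -> T -> R) :
  (forall i, measurable_fun setT (X i)) -> product_rule P X -> iid_std_normal P X.
Proof.
move=> mX prX; split => // B mB.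
transitivity (\int[P]_w \prod_i ((\1_(B i) (X i w))%:E : \bar R))%E; last first.
  rewrite (prX (fun i x => (\1_(B i) x)%:E)).
  - apply: eq_bigr => i _; rewrite integral_indic//; last exact: mB.
    by congr (normal_prob 0 1 _); exact: setIT.
  - by move=> i; exact/measurable_EFinP/measurable_indic.
  - by move=> i x; rewrite lee_fin.
rewrite -[in LHS](setIT (\bigcap_(_ in _) _)) -integral_indic//; last first.
  apply: fin_bigcap_measurable => // i _.
  by rewrite -[X in measurable X]setTI; exact: mX.
apply: eq_integral => w _; rewrite indicE.
have [wB|wB] := pselect ((\bigcap_(i in [set: I]) (X i @^-1` B i)) w).
  rewrite mem_set// big1// => i _; rewrite indicE mem_set//; exact: wB.
rewrite memNset//.
have [i wBi] : exists i, ~ B i (X i w).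
  by apply: contrapT => /forallNP h; apply: wB => i _; apply: contrapT; exact: h.
by rewrite (bigD1 i)//= indicE memNset// mul0e.
Qed.

Lemma exists_product_rule_ord (n : nat) :
  exists (d : measure_display) (T : measurableType d) (P : probability T R)
    (X : 'I_n -> T -> R), (forall i, measurable_fun setT (X i)) /\ product_rule P X.
Proof.
elim: n => [|n [d [T [P [X [mX prX]]]]]].
  exists _, (measurableTypeR R), (normal_prob 0 1), (fun _ _ => 0); split => [[]//|f _ _].
  by rewrite !big_ord0 integral_cst// mul1e; exact: probability_setT.
(* The new normal variable is the second component of the product space and receives the last
   index. *)
pose X' (i : 'I_n.+1) (w : T * measurableTypeR R) : R :=
  if unlift ord_max i is Some j then X j w.1 else w.2.
have mX' i : measurable_fun setT (X' i).
  rewrite /X'; case: unlift => [j|]; last exact: measurable_snd.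
  exact: measurableT_comp.
exists _, (T * measurableTypeR R)%type, (prod_prob P (normal_prob 0 1)), X'.
split => // f mf f0.
have f00 (J : Type) (s : seq J) (g : J -> \bar R) :
    (forall j, 0 <= g j)%E -> (0 <= \prod_(j <- s) g j)%E.
  by move=> g0; elim/big_ind : _ => // *; exact: mule_ge0.
rewrite ge0_integral_prod_prob; last 2 first.
- by apply: emeasurable_prod => i; apply: measurableT_comp.
- by move=> z; exact: f00.
have X'E w (x : measurableTypeR R) : (\prod_i f i (X' i (w, x)) =
    \prod_(i < n) f (lift ord_max i) (X i w) * f ord_max x)%E.
  rewrite big_ord_recr /=; congr (_ * _)%E; last by rewrite /X' unlift_none.
  apply: eq_bigr => i _; have -> : widen_ord (leqnSn n) i = lift ord_max i.
    by apply/val_inj; rewrite /= /bump leqNgt ltn_ord.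
  by rewrite /X' liftK.
under eq_integral => w _ do under eq_integral do rewrite X'E.
have innerE w : (\int[nu]_x (\prod_(i < n) f (lift ord_max i) (X i w) * f ord_max x) =
    \prod_(i < n) f (lift ord_max i) (X i w) * \int[nu]_x f ord_max x)%E.
  by apply: ge0_integralZl => //; [exact: mf | exact: f00].
rewrite (eq_integral _ _ (fun w _ => innerE w)) ge0_integralZr//=; last 3 first.
- by apply: emeasurable_prod => i; apply: measurableT_comp; [exact: mf|exact: mX].
- by move=> w _; exact: f00.
- by apply: integral_ge0 => x _; exact: f0.
rewrite (prX (fun i => f (lift ord_max i)))// big_ord_recr/=; congr (_ * _)%E.
apply: eq_bigr => i _; suff -> : widen_ord (leqnSn n) i = lift ord_max i by [].
by apply/val_inj; rewrite /= /bump leqNgt ltn_ord.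
Qed.

Lemma exists_product_rule (I : finType) :
  exists (d : measure_display) (T : measurableType d) (P : probability T R)
    (X : I -> T -> R), (forall i, measurable_fun setT (X i)) /\ product_rule P X.
Proof.
have [d [T [P [X [mX prX]]]]] := exists_product_rule_ord #|I|.
exists d, T, P, (fun i => X (enum_rank i)); split => // f mf f0.
rewrite (reindex _ (onW_bij _ (enum_val_bij I))) /=.
rewrite -(prX (fun i => f (enum_val i)))//; apply: eq_integral => w _.
rewrite (reindex _ (onW_bij _ (enum_val_bij I))) /=.
by apply: eq_bigr => i _; rewrite enum_valK.
Qed.

Lemma exists_iid_std_normal (I : finType) :
  exists (d : measure_display) (T : measurableType d) (P : probability T R)
    (X : I -> T -> R), iid_std_normal P X.
Proof.
have [d [T [P [X [mX prX]]]]] := exists_product_rule I.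
by exists d, T, P, X; exact: product_rule_iid.
Qed.

(** The rule holds on the space constructed above, and equality of laws transfers it to an arbitrary
    i.i.d. family. *)
Lemma iid_product_rule d (T : measurableType d) (P : probability T R)
    (I : finType) (X : I -> T -> R) : iid_std_normal P X -> product_rule P X.
Proof.
move=> iX f mf f0.
have [d' [T' [P' [X' [mX' prX']]]]] := exists_product_rule I.
rewrite -prX'//.
apply: (iid_std_normal_integral_eq (f := fun z => (\prod_i f i (z i))%E)) => //.
- exact: product_rule_iid.
- by move=> d0 T0 Z mZ; apply: emeasurable_prod => i; exact: measurableT_comp.
- by move=> z; elim/big_ind : _ => // *; exact: mule_ge0.
Qed.

Lemma iid_pair d1 (T1 : measurableType d1) (P1 : probability T1 R)
    (I1 : finType) (X1 : I1 -> T1 -> R) d2 (T2 : measurableType d2)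
    (P2 : probability T2 R) (I2 : finType) (X2 : I2 -> T2 -> R) :
  iid_std_normal P1 X1 -> iid_std_normal P2 X2 ->
  iid_std_normal (prod_prob P1 P2) (fun (e : I1 + I2) w =>
    match e with inl i => X1 i w.1 | inr j => X2 j w.2 end).
Proof.
move=> [mX1 iX1] [mX2 iX2]; split => [[i|j]|B mB].
- exact: measurableT_comp.
- exact: measurableT_comp.
rewrite big_sumType /= -iX1// -iX2// -prod_probE; last 2 first.
- by apply: fin_bigcap_measurable => // i _; rewrite -[X in measurable X]setTI; exact: mX1.
- by apply: fin_bigcap_measurable => // i _; rewrite -[X in measurable X]setTI; exact: mX2.
congr (prod_prob P1 P2 _); apply/seteqP; split => [[x y] /= h|[x y] /= [h1 h2] [i|j] _].
- by split => i _; [exact: (h (inl i))|exact: (h (inr i))].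
- exact: h1.
- exact: h2.
Qed.

End iid_product.

(** * The standard normal law *)

Section standard_normal.
Context {R : realType}.
Local Notation mu := (@lebesgue_measure R).
Local Notation nu := (normal_prob (0 : R) 1).
Local Notation p := (normal_pdf (0 : R) 1).

Lemma ge0_integral_normal (f : R -> \bar R) : measurable_fun setT f ->
  (forall x, 0 <= f x)%E -> (\int[nu]_x f x = \int[mu]_x (f x * (p x)%:E))%E.
Proof.
move=> mf f0; apply: (@ge0_integral_density _ _ _ mu nu p) => //.
- exact: normal_pdf_ge0.
- exact: measurable_normal_pdf.
Qed.

Lemma normal_prob_indic (A : set R) : measurable A ->
  nu A = (\int[mu]_x ((\1_A x)%:E * (p x)%:E))%E.
Proof.
move=> mA; rewrite /normal_prob integral_mkcond; apply: eq_integral => x _.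
by rewrite epatch_indic /= muleC.
Qed.

(** Both sides are the joint density of [x] and [z = b x + a y]. The left conditions [z] on [x]; the
    right conditions [x] on [z], which gives a normal law of mean [b z] and standard deviation
    [a]. *)
Lemma normal_pdf_rotation (a b x z : R) : 0 < a -> a ^+ 2 + b ^+ 2 = 1 ->
  p ((z - b * x) / a) / a * p x = p z * normal_pdf (b * z) a x.
Proof.
move=> a0 ab; have an0 : a != 0 by rewrite gt_eqF.
rewrite !normal_pdfE ?oner_eq0//.
have -> : normal_peak a = normal_peak 1 / a.
  rewrite /normal_peak expr1n mul1r -mulrnAr sqrtrM ?sqr_ge0// sqrtr_sqr gtr0_norm//.
  by rewrite invfM mulrC.
rewrite /normal_fun.
have -> : - (x - b * z) ^+ 2 / (a ^+ 2 *+ 2) =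
    - ((z - b * x) / a - 0) ^+ 2 / (1 ^+ 2 *+ 2) +
    - (x - 0) ^+ 2 / (1 ^+ 2 *+ 2) + (z - 0) ^+ 2 / (1 ^+ 2 *+ 2).
  have h : (x - b * z) ^+ 2 = (z - b * x) ^+ 2 + a ^+ 2 * x ^+ 2 - a ^+ 2 * z ^+ 2.
    have -> : a ^+ 2 = 1 - b ^+ 2 by rewrite -ab addrK.
    by ring.
  by rewrite h; field.
rewrite !expRD [- _ / _ in RHS]mulNr expRN.
have : expR ((z - 0) ^+ 2 / (1 ^+ 2 *+ 2)) != 0 by rewrite gt_eqF// expR_gt0.
by move=> ?; field; rewrite an0.
Qed.

(* Stability: [b x + a y] is again standard normal when [x] and [y] are independent
   standard normal. *)
Lemma normal_stable (a b : R) (B : set R) : 0 < a -> a ^+ 2 + b ^+ 2 = 1 -> measurable B ->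
  (\int[nu]_x nu [set y | B (b * x + a * y)%R] = nu B)%E.
Proof.
move=> a0 ab mB; have an0 : a != 0 by rewrite gt_eqF.
(* Density at [z] of [b x + a y] for fixed [x], cut down to [B]. *)
pose q (x z : R) : R := \1_B z * (p ((z - b * x) / a) / a).
have q0 x z : 0 <= q x z.
  by rewrite /q !mulr_ge0 ?normal_pdf_ge0// invr_ge0 ltW.
have mp : measurable_fun setT p by exact: measurable_normal_pdf.
have mq : measurable_fun setT (fun xz : R * R => q xz.1 xz.2).
  apply: measurable_funM.
    have m1B : measurable_fun setT (\1_B : R -> R) by exact: measurable_indic.
    exact: (measurableT_comp m1B measurable_snd).
  apply: measurable_funM => //; apply: measurableT_comp => //.
  apply: measurable_funM => //; apply: measurable_funB => //.
  exact: measurable_funM.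
have mqx x : measurable_fun setT (q x).
  exact: (measurableT_comp mq (pair1_measurable x)).
have nuq x : nu [set y | B (b * x + a * y)] = (\int[mu]_z (q x z)%:E)%E.
  have mBx : measurable [set y | B (b * x + a * y)].
    rewrite -[X in measurable X]setTI.
    have : measurable_fun setT (fun y : R => b * x + a * y).
      by apply: measurable_funD => //; exact: measurable_funM.
    exact.
  rewrite normal_prob_indic// [RHS](ge0_integral_affine (b * x) a0); last 2 first.
  - exact/measurable_EFinP.
  - by move=> z; rewrite lee_fin.
  rewrite -ge0_integralZl//; last 3 first.
  - apply/measurable_EFinP; apply: measurableT_comp => //.
    by apply: measurable_funD => //; exact: measurable_funM.
  - by move=> z _; rewrite lee_fin.
  - by rewrite lee_fin ltW.
  apply: eq_integral => y _; rewrite -!EFinM; congr EFin; rewrite /q.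
  have -> : (a * y + b * x - b * x) / a = y by field.
  have -> : \1_[set y | B (b * x + a * y)] y = \1_B (a * y + b * x) :> R.
    by rewrite !indicE addrC.
  by field.
under eq_integral do rewrite nuq.
rewrite ge0_integral_normal; last 2 first.
- apply: (measurable_fun_fubini_tonelli_F (m2 := mu) (fun xz : R * R => (q xz.1 xz.2)%:E)).
    exact/measurable_EFinP.
  by move=> z; rewrite lee_fin.
- by move=> x; apply: integral_ge0 => z _; rewrite lee_fin.
transitivity (\int[mu]_x \int[mu]_z ((q x z * p x)%:E))%E.
  apply: eq_integral => x _; rewrite -ge0_integralZr//.
  - by apply/measurable_EFinP; exact: mqx.
  - by move=> z _; rewrite lee_fin.
  - by rewrite lee_fin normal_pdf_ge0.
(* Once [x] is the inner variable, [normal_pdf_rotation] leaves the integral of a normal density in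
   [x], which is 1. *)
rewrite (fubini_tonelli (m1 := mu) (m2 := mu)
  (fun xz : R * R => (q xz.1 xz.2 * p xz.1)%:E)); last 2 first.
- by apply/measurable_EFinP; apply: measurable_funM => //; apply: measurableT_comp.
- by move=> z; rewrite lee_fin mulr_ge0// normal_pdf_ge0.
rewrite normal_prob_indic//; apply: eq_integral => z _ /=.
rewrite /fubini_G /=.
transitivity (\int[mu]_x ((\1_B z * p z)%:E * (normal_pdf (b * z) a x)%:E))%E.
  apply: eq_integral => x _; rewrite -EFinM; congr EFin.
  by rewrite /q -!mulrA; congr (_ * _); rewrite mulrA normal_pdf_rotation.
rewrite ge0_integralZl//; last 3 first.
- by apply/measurable_EFinP; exact: measurable_normal_pdf.
- by move=> x _; rewrite lee_fin normal_pdf_ge0.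
- by rewrite lee_fin mulr_ge0// normal_pdf_ge0.
by rewrite integral_normal_pdf mule1.
Qed.

Lemma normal_prob_opp (A : set R) : measurable A -> nu [set x | A (- x)] = nu A.
Proof.
move=> mA.
have mN : measurable_fun setT (-%R : R -> measurableTypeR R) by [].
have mA' : measurable [set x | A (- x)] by rewrite -[X in measurable X]setTI; exact: mN.
rewrite !normal_prob_indic//.
rewrite [RHS](eq_measure_integral (pushforward mu (-%R : R -> measurableTypeR R))); last first.
  by move=> B mB _; exact/esym/lebesgue_measureN.
rewrite ge0_integral_pushforward//; last 2 first.
- apply: emeasurable_funM; apply/measurable_EFinP; first exact: measurable_indic.
  exact: measurable_normal_pdf.
- by move=> x _; rewrite mule_ge0// lee_fin ?normal_pdf_ge0.
rewrite preimage_setT; apply: eq_integral => x _ /=; congr (_ * _)%E; last first.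
  by congr EFin; rewrite !normal_pdfE ?oner_eq0// /normal_fun !subr0 sqrrN.
Qed.

(** The half-line and its reflection have equal mass and together cover the line. *)
Lemma normal_prob_le0 : ((2^-1)%:E <= nu `]-oo, 0%R]%classic)%E.
Proof.
have : (1 <= nu `]-oo, 0%R]%classic + nu `]-oo, 0%R]%classic)%E.
  rewrite -{1}(@normal_prob_opp `]-oo, 0]%classic); last exact: measurable_itv.
  rewrite -(@probability_setT _ _ _ nu).
  have -> : [set: R] = [set x | `]-oo, 0%R]%classic (- x)] `|` `]-oo, 0%R]%classic.
    apply/esym; rewrite -subTset => x _ /=; rewrite !in_itv/= oppr_le0.
    by have [|/ltW] := leP x 0; [right|left].
  have mN : measurable_fun setT (-%R : R -> measurableTypeR R) by [].
  have mA : measurable (`]-oo, 0]%classic : set R) by exact: measurable_itv.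
  apply: measureU2 => //.
  by rewrite -[X in measurable X]setTI; exact: mN.
have : (nu `]-oo, 0%R]%classic \is a fin_num) by exact: fin_num_measure.
case: (nu _) => // r _; rewrite -EFinD !lee_fin => h; lra.
Qed.

(** Half of the Gaussian exponent absorbs the cubic factor, the other half is the density of
    variance 2. With [u = x^2 / 4] it remains to see [1 + 16 u^2 <= 65 exp u]: one copy of [exp u]
    covers 1, and 64 copies cover [16 u^2] because [exp u >= (1 + u/2)^2]. *)
Lemma cube_normal_pdf (x : R) :
  `|x| ^+ 3 * p x <= 65 * normal_peak 1 / normal_peak (Num.sqrt 2) * normal_pdf 0 (Num.sqrt 2) x.
Proof.
have s2 : Num.sqrt 2 != 0 :> R by rewrite gt_eqF// sqrtr_gt0.
rewrite !normal_pdfE ?oner_eq0//.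
have pk0 : normal_peak (Num.sqrt 2) != 0 :> R by rewrite gt_eqF// normal_peak_gt0.
rewrite (_ : _ / _ * _ = normal_peak 1 * (65 * normal_fun 0 (Num.sqrt 2) x)); last by field.
rewrite mulrCA ler_pM2l ?normal_peak_gt0 ?oner_eq0//.
rewrite /normal_fun !subr0 sqr_sqrtr//.
have -> : - x ^+ 2 / (1 ^+ 2 *+ 2) = - x ^+ 2 / (2 *+ 2) + - x ^+ 2 / (2 *+ 2) by field.
rewrite expRD mulrA ler_pM2r ?expR_gt0//.
set u := x ^+ 2 / (2 *+ 2); have u0 : 0 <= u by rewrite /u divr_ge0// sqr_ge0.
have -> : - x ^+ 2 / (2 *+ 2) = - u by rewrite mulNr.
rewrite expRN ler_pdivrMr ?expR_gt0//.
have e2 : (1 + u / 2) ^+ 2 <= expR u.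
  have -> : u = u / 2 + u / 2 by field.
  rewrite expRD -expr2; have -> : (u / 2 + u / 2) / 2 = u / 2 by field.
  have h := expR_ge1Dx (u / 2).
  by rewrite ler_sqr// nnegrE ?expR_ge0//; lra.
have x4 : `|x| ^+ 4 = 16 * u ^+ 2.
  by rewrite -[4%N]/(2 * 2)%N exprM -normrX ger0_norm ?sqr_ge0// /u; field.
have : `|x| ^+ 3 <= 1 + `|x| ^+ 4.
  have [x1|x1] := leP `|x| 1.
    by rewrite (@le_trans _ _ 1)// ?exprn_ile1// lerDl exprn_ge0.
  by rewrite (@le_trans _ _ (`|x| ^+ 4))// ?lerDr// ler_eXn2l.
nra.
Qed.

Lemma integral_normal_cube_lty : (\int[nu]_x ((`|x| ^+ 3)%:E) < +oo)%E.
Proof.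
have m3 : measurable_fun setT (fun x : R => `|x| ^+ 3).
  by apply: measurable_funX; exact: normr_measurable.
rewrite ge0_integral_normal; [|by apply/measurable_EFinP; exact: m3|];
  last by move=> x; rewrite lee_fin exprn_ge0.
set K := 65 * normal_peak 1 / normal_peak (Num.sqrt 2) : R.
have K0 : 0 <= K by rewrite /K divr_ge0// ?mulr_ge0// normal_peak_ge0.
apply: (@le_lt_trans _ _ (\int[mu]_x (K%:E * (normal_pdf 0 (Num.sqrt 2) x)%:E))%E).
  apply: ge0_le_integral => //.
  - by move=> x _; rewrite -EFinM lee_fin mulr_ge0 ?exprn_ge0// normal_pdf_ge0.
  - apply: emeasurable_funM; apply/measurable_EFinP; first exact: m3.
    exact: measurable_normal_pdf.
  - apply: emeasurable_funM; first exact: measurable_cst.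
    by apply/measurable_EFinP; exact: measurable_normal_pdf.
  - by move=> x _; rewrite -!EFinM lee_fin cube_normal_pdf.
rewrite ge0_integralZl//; last 2 first.
- by apply/measurable_EFinP; exact: measurable_normal_pdf.
- by move=> x _; rewrite lee_fin normal_pdf_ge0.
by rewrite integral_normal_pdf mule1 ltry.
Qed.

End standard_normal.

(** * Rotations, sign changes and moments of i.i.d. families *)

Section iid_transformations.
Context {R : realType}.
Local Notation nu := (normal_prob (0 : R) 1).

Lemma ge0_integral_normal_stable (a b : R) (f : R -> \bar R) : 0 < a -> a ^+ 2 + b ^+ 2 = 1 ->
  measurable_fun setT f -> (forall x, 0 <= f x)%E ->
  (\int[nu]_x \int[nu]_y f (b * x + a * y)%R = \int[nu]_x f x)%E.
Proof.
move=> a0 ab mf f0.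
pose T (z : measurableTypeR R * measurableTypeR R) : measurableTypeR R := b * z.1 + a * z.2.
have mT : measurable_fun setT T.
  by apply: measurable_funD; apply: measurable_funM => //; exact: measurable_cst.
rewrite -(@ge0_integral_prod_prob _ _ _ _ R nu nu (f \o T)); last 2 first.
- exact: measurableT_comp.
- by move=> z; exact: f0.
rewrite [RHS](eq_measure_integral (pushforward (prod_prob nu nu) T)); last first.
  move=> A mA _; apply/esym; apply: etrans (normal_stable a0 ab mA).
  apply: eq_integral => x _ /=; congr (normal_prob 0 1 _).
  by apply/seteqP; split => y; rewrite /xsection /= inE.
by rewrite ge0_integral_pushforward.
Qed.

(** Integrating out [X2] for fixed [x] and then [X1] splits the integral into one factor per
    coordinate, where one-dimensional stability applies. *)
Lemma iid_rotation d1 (T1 : measurableType d1) (P1 : probability T1 R)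
    d2 (T2 : measurableType d2) (P2 : probability T2 R) (I : finType)
    (X1 : I -> T1 -> R) (X2 : I -> T2 -> R) (a b : R) :
  0 < a -> a ^+ 2 + b ^+ 2 = 1 -> iid_std_normal P1 X1 -> iid_std_normal P2 X2 ->
  iid_std_normal (prod_prob P1 P2) (fun i w => b * X1 i w.1 + a * X2 i w.2).
Proof.
move=> a0 ab iX1 iX2.
have [mX1 _] := iX1; have [mX2 _] := iX2.
have mX i : measurable_fun setT (fun w : T1 * T2 => b * X1 i w.1 + a * X2 i w.2).
  by apply: measurable_funD; apply: measurable_funM; do ?exact: measurable_cst;
    exact: measurableT_comp.
apply: product_rule_iid => // f mf f0.
have mprod : measurable_fun setT (fun w : T1 * T2 =>
    (\prod_i f i (b * X1 i w.1 + a * X2 i w.2)%R)%E).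
  by apply: emeasurable_prod => i; exact: (measurableT_comp (mf i) (mX i)).
rewrite ge0_integral_prod_prob//; last by move=> z; exact: prode_ge0.
have mfx i (x : R) : measurable_fun setT (fun y : R => f i (b * x + a * y)).
  apply: measurableT_comp => //; apply: measurable_funD => //; exact: measurable_funM.
transitivity (\int[P1]_x \prod_i \int[nu]_y f i (b * X1 i x + a * y)%R)%E.
  apply: eq_integral => x _.
  by rewrite -(iid_product_rule iX2 (f := fun i y => f i (b * X1 i x + a * y))).
rewrite (iid_product_rule iX1 (f := fun i u => (\int[nu]_y f i (b * u + a * y)%R)%E)).
- by apply: eq_bigr => i _; exact: ge0_integral_normal_stable.
- move=> i; apply: (@measurable_integral_snd _ _ _ _ R nu
    (fun z : R * R => f i (b * z.1 + a * z.2))) => //.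
  apply: measurableT_comp => //.
  by apply: measurable_funD; apply: measurable_funM => //; exact: measurable_cst.
- by move=> i x; apply: integral_ge0.
Qed.

(** Dividing by [c] puts the coefficients on the unit circle and reduces the claim to
    [iid_rotation]. *)
Lemma iid_integral_stable d1 (T1 : measurableType d1) (P1 : probability T1 R)
    d2 (T2 : measurableType d2) (P2 : probability T2 R)
    d3 (T3 : measurableType d3) (P3 : probability T3 R) (I : finType)
    (X1 : I -> T1 -> R) (X2 : I -> T2 -> R) (X3 : I -> T3 -> R) (a b c : R)
    (f : (I -> R) -> \bar R) :
  0 < a -> 0 <= c -> c ^+ 2 = a ^+ 2 + b ^+ 2 ->
  iid_std_normal P1 X1 -> iid_std_normal P2 X2 -> iid_std_normal P3 X3 ->
  coord_measurable f -> (forall z, 0 <= f z)%E ->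
  (\int[P3]_w f (fun i => c * X3 i w)%R =
   \int[P1]_x \int[P2]_y f (fun i => b * X1 i x + a * X2 i y)%R)%E.
Proof.
move=> a0 c0 cab iX1 iX2 iX3 mf f0.
have [mX1 _] := iX1; have [mX2 _] := iX2.
have cp : 0 < c.
  rewrite lt_neqAle c0 andbT; apply/eqP => h.
  have : 0 < a ^+ 2 + b ^+ 2 by rewrite ltr_wpDr ?sqr_ge0// exprn_gt0.
  by rewrite -cab -h expr0n ltxx.
have ac0 : 0 < a / c by rewrite divr_gt0.
have ab1 : (a / c) ^+ 2 + (b / c) ^+ 2 = 1.
  by rewrite !expr_div_n -mulrDl -cab divff// expf_neq0// gt_eqF.
have iX12 := iid_rotation ac0 ab1 iX1 iX2.
rewrite (iid_std_normal_integral_eq (f := fun z => f (fun i => c * z i)) iX3 iX12) //; last first.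
  move=> d T Z mZ; apply: mf => i; apply: measurable_funM => //; exact: measurable_cst.
have E w : (fun i => c * (b / c * X1 i w.1 + a / c * X2 i w.2)) =
    (fun i => b * X1 i w.1 + a * X2 i w.2).
  by apply/funext => i; field; rewrite gt_eqF.
under eq_integral do rewrite E.
rewrite ge0_integral_prod_prob//.
apply: mf => i; apply: measurable_funD; apply: measurable_funM;
  do ?exact: measurable_cst; exact: measurableT_comp.
Qed.

Lemma iid_flip d (T : measurableType d) (P : probability T R) (I : finType)
    (X : I -> T -> R) (i0 : I) : iid_std_normal P X ->
  iid_std_normal P (fun i w => if i == i0 then - X i w else X i w).
Proof.
move=> [mX iX]; split => [i|B mB].
  by case: (i == i0) => //; exact: measurableT_comp.
have mN : measurable_fun setT (-%R : R -> measurableTypeR R) by [].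
have mB' : measurable [set x | B i0 (- x)].
  by rewrite -[X in measurable X]setTI; exact: (mN _ _ (mB i0)).
transitivity (P (\bigcap_(i in [set: I])
    (X i @^-1` (if i == i0 then [set x | B i (- x)] else B i)))).
  congr (P _); apply: eq_bigcapr => i _.
  by case: (i == i0).
rewrite iX; last by move=> i; case: eqP => // ->.
by apply: eq_bigr => i _; case: eqP => [->|//]; exact: normal_prob_opp.
Qed.

End iid_transformations.

Section moments.
Context {R : realType} d (T : measurableType d) (P : probability T R) (I : finType).
Variables (X : I -> T -> R).
Hypothesis iX : iid_std_normal P X.
Local Notation nu := (normal_prob (0 : R) 1).

Let mX i : measurable_fun setT (X i). Proof. by case: iX. Qed.

Lemma ge0_integral_coord i (f : R -> \bar R) : measurable_fun setT f ->
  (forall x, 0 <= f x)%E -> (\int[P]_w f (X i w) = \int[nu]_x f x)%E.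
Proof.
move=> mf f0.
have := iid_product_rule iX (f := fun j x => if j == i then f x else 1%E).
rewrite (bigD1 i)//= eqxx big1 ?mule1; last first.
  move=> j /negbTE ->; rewrite integral_cst//= mul1e; exact: probability_setT.
move=> <-.
- apply: eq_integral => w _; rewrite (bigD1 i)//= eqxx big1 ?mule1// => j.
  by move=> /negbTE ->.
- by move=> j; case: (j == i) => //; exact: measurable_cst.
- by move=> j x; case: (j == i).
Qed.

Let cube_integrable i : P.-integrable setT (fun w => (`|X i w| ^+ 3)%:E).
Proof.
apply/integrableP; split.
  by apply/measurable_EFinP; apply: measurable_funX; exact: measurableT_comp.
under eq_integral do rewrite gee0_abs ?lee_fin ?exprn_ge0//.
rewrite (@ge0_integral_coord i (fun x => (`|x| ^+ 3)%:E)).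
- exact: integral_normal_cube_lty.
- by apply/measurable_EFinP; apply: measurable_funX; exact: normr_measurable.
- by move=> x; rewrite lee_fin exprn_ge0.
Qed.

(** Everything integrated in the exchange is a polynomial of degree at most two or a cubic
    remainder, so the third moment of each coordinate dominates it. *)
Lemma integrable_cubic_growth (f : T -> R) (K : R) : measurable_fun setT f ->
  (forall w, `|f w| <= K * (1 + \sum_i `|X i w| ^+ 3)) ->
  P.-integrable setT (EFin \o f).
Proof.
move=> mf fK.
apply: (@le_integrable _ _ _ P setT measurableT _
  (fun w => (K%:E * (1%:E + \sum_i (`|X i w| ^+ 3)%:E))%E)).
- exact/measurable_EFinP.
- move=> w _; rewrite sumEFin -EFinD -EFinM !abse_EFin lee_fin.
  exact: le_trans (fK w) (ler_norm _).
- apply: integrableZl => //; apply: integrableD => //.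
    by apply: finite_measure_integrable_cst.
  apply: integrable_sum => //.
Qed.

Lemma integral_odd_eq0 (f : (I -> R) -> R) (i0 : I) : coord_measurable (EFin \o f) ->
  P.-integrable setT (fun w => (f (X^~ w))%:E) ->
  (forall z, f (fun i => if i == i0 then - z i else z i) = - f z) ->
  (\int[P]_w (f (X^~ w))%:E = 0)%E.
Proof.
move=> mf intf fN.
rewrite integralE.
(* Equality of laws is available for nonnegative functions, so it is applied to the positive part;
   flipping the coordinate [i0] turns it into the negative part. *)
have -> : (\int[P]_w (fun w => (f (X^~ w))%:E)^\- w =
           \int[P]_w (fun w => (f (X^~ w))%:E)^\+ w)%E.
  under eq_integral do rewrite funenegE.
  under [RHS]eq_integral do rewrite funeposE.
  rewrite [RHS](iid_std_normal_integral_eq (f := fun z => maxe (f z)%:E 0%E) iX (iid_flip i0 iX)).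
  - by apply: eq_integral => w _; rewrite fN.
  - by move=> d0 T0 Z mZ; apply: measurable_maxe; [exact: mf|exact: measurable_cst].
  - by move=> z; rewrite le_max lexx orbT.
by rewrite subee// integrable_pos_fin_num.
Qed.

End moments.

(** * Lindeberg exchange *)

Section has_mean.
Context {R : realType} d (T : measurableType d) (P : probability T R).

(** Integrability is bundled with a real value so that expectations can be combined by real
    arithmetic. *)
Definition has_mean (f : T -> R) (e : R) :=
  P.-integrable setT (EFin \o f) /\ (\int[P]_w (f w)%:E = e%:E)%E.

Lemma has_mean_cst c : has_mean (fun=> c) c.
Proof.
split; first exact: finite_measure_integrable_cst.
rewrite (integral_cst P measurableT) -[RHS]mule1; congr (_ * _)%E.
exact: probability_setT.
Qed.

Lemma has_meanD f g a b : has_mean f a -> has_mean g b ->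
  has_mean (fun w => f w + g w) (a + b).
Proof.
move=> [f1 f2] [g1 g2]; split; first by apply: (integrableD measurableT f1 g1).
by under eq_integral do rewrite EFinD; rewrite (integralD measurableT f1 g1)/= f2 g2.
Qed.

Lemma has_meanZ c f a : has_mean f a -> has_mean (fun w => c * f w) (c * a).
Proof.
move=> [f1 f2]; split; first by apply: (integrableZl measurableT c f1).
by under eq_integral do rewrite EFinM; rewrite (integralZl measurableT f1)/= f2.
Qed.

Lemma has_mean_sum (J : Type) (s : seq J) (f : J -> T -> R) (a : J -> R) :
  (forall j, has_mean (f j) (a j)) ->
  has_mean (fun w => \sum_(j <- s) f j w) (\sum_(j <- s) a j).
Proof.
move=> h; elim: s => [|j s IH].
  by under eq_fun do rewrite big_nil; rewrite big_nil; exact: has_mean_cst.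
by under eq_fun do rewrite big_cons; rewrite big_cons; exact: has_meanD.
Qed.

Lemma has_mean_le f g a b : has_mean f a -> has_mean g b ->
  (forall w, f w <= g w) -> a <= b.
Proof.
move=> [f1 f2] [g1 g2] fg; rewrite -lee_fin -f2 -g2; apply: le_integral => // w _.
by rewrite lee_fin.
Qed.

Lemma has_mean_fine f : P.-integrable setT (EFin \o f) ->
  has_mean f (fine (\int[P]_w (f w)%:E)%E).
Proof. by move=> intf; split => //; rewrite fineK//; exact: integrable_fin_num. Qed.

Lemma has_mean_bounded (f : T -> R) : measurable_fun setT f ->
  (forall w, 0 <= f w <= 1) -> has_mean f (fine (\int[P]_w (f w)%:E)%E).
Proof.
move=> mf f01; apply: has_mean_fine.
apply: (@le_integrable _ _ _ P setT measurableT _ (EFin \o cst 1)).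
- exact/measurable_EFinP.
- move=> w _; have /andP[? ?] := f01 w.
  by rewrite !abse_EFin lee_fin normr1 ger0_norm.
- exact: finite_measure_integrable_cst.
Qed.

End has_mean.

(** Induction from [(x + u)^3 <= 4 (x^3 + u^3)], hence the constant [4 + 4 * B]. *)
Lemma sum_cube_le (R : realType) (I : Type) (s : seq I) :
  exists2 B : R, 0 <= B & forall x : I -> R, (forall i, 0 <= x i) ->
    (\sum_(i <- s) x i) ^+ 3 <= B * \sum_(i <- s) x i ^+ 3.
Proof.
elim: s => [|i s [B B0 IH]].
  by exists 0 => // x _; rewrite !big_nil expr0n mul0r.
exists (4 + 4 * B) => [|x x0]; first by rewrite addr_ge0// mulr_ge0.
rewrite !big_cons; have := IH x x0; have xi := x0 i.
have : 0 <= \sum_(j <- s) x j by apply: sumr_ge0.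
have : 0 <= \sum_(j <- s) x j ^+ 3 by apply: sumr_ge0 => j _; rewrite exprn_ge0.
move: (\sum_(j <- s) x j) (\sum_(j <- s) x j ^+ 3) => u v v0 u0 uv.
have h : (x i + u) ^+ 3 <= 4 * (x i ^+ 3 + u ^+ 3).
  rewrite -subr_ge0.
  rewrite (_ : _ - _ = 3 * ((x i + u) * (x i - u) ^+ 2)); last by ring.
  by apply: mulr_ge0 => //; apply: mulr_ge0; [exact: addr_ge0 | exact: sqr_ge0].
have xi3 : 0 <= x i ^+ 3 by rewrite exprn_ge0.
have := mulr_ge0 B0 v0; have := mulr_ge0 B0 xi3; nra.
Qed.

Section lindeberg.
Context {R : realType} d (T : measurableType d) (P : probability T R) (I : finType).
Variables (X : I -> T -> R).
Hypothesis iX : iid_std_normal P X.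
Local Notation nu := (normal_prob (0 : R) 1).

Let mX i : measurable_fun setT (X i). Proof. by case: iX. Qed.

(** The common second moment stays a symbol: [lindeberg_step] only multiplies an inequality by
    it. *)
Let var : R := fine (\int[nu]_x (x ^+ 2)%:E)%E.

Let var_ge0 : 0 <= var.
Proof. by rewrite fine_ge0//; apply: integral_ge0 => x _; rewrite lee_fin sqr_ge0. Qed.

Let cube_le (i : I) (w : T) : `|X i w| ^+ 3 <= \sum_i `|X i w| ^+ 3.
Proof. by rewrite (bigD1 i)//= lerDl sumr_ge0. Qed.

Let norm_le_cube (x : R) : 0 <= x -> x <= 1 + x ^+ 3.
Proof.
move=> x0; have := sqr_ge0 (x - 1); have := mulr_ge0 x0 (sqr_ge0 (x - 1)).
have := exprn_ge0 3 x0; nra.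
Qed.

Let sqr_le_cube (x : R) : 0 <= x -> x ^+ 2 <= 1 + x ^+ 3.
Proof.
move=> x0; have [x1|x1] := leP x 1.
  by have := exprn_ge0 3 x0; have := exprn_ile1 2 x0 x1; lra.
have : x ^+ 2 <= x ^+ 3 by rewrite ler_eXn2l.
lra.
Qed.

Lemma has_mean_coord i : has_mean P (X i) 0.
Proof.
have intX : P.-integrable setT (EFin \o X i).
  apply: (integrable_cubic_growth iX (K := 1)) => // w; rewrite mul1r.
  by rewrite (le_trans (norm_le_cube (normr_ge0 _)))// lerD2l.
split=> //; apply: (integral_odd_eq0 (f := fun z => z i) iX (i0 := i)) => //.
- by move=> d0 T0 Z mZ; exact/measurable_EFinP.
- by move=> z; rewrite eqxx.
Qed.

Lemma has_mean_coordM i j :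
  has_mean P (fun w => X i w * X j w) (if i == j then var else 0).
Proof.
have intX : P.-integrable setT (EFin \o (fun w => X i w * X j w)).
  apply: (integrable_cubic_growth iX (K := 2)); first exact: measurable_funM.
  move=> w; rewrite normrM.
  have := sqr_le_cube (normr_ge0 (X i w)); have := sqr_le_cube (normr_ge0 (X j w)).
  have := cube_le i w; have := cube_le j w.
  have := sqr_ge0 (`|X i w| - `|X j w|); nra.
case: (eqVneq i j) => [eij|ij]; last first.
  (* For [i != j] the product is odd in the coordinate [i]. *)
  split=> //; apply: (integral_odd_eq0 (f := fun z => z i * z j) iX (i0 := i)) => //.
  - by move=> d0 T0 Z mZ; apply/measurable_EFinP; exact: measurable_funM.
  - by move=> z; rewrite eqxx eq_sym (negbTE ij) mulNr.
subst j; suff -> : var = fine (\int[P]_w (X i w * X i w)%:E)%E by exact: has_mean_fine.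
congr fine; apply/esym; rewrite -(@ge0_integral_coord _ _ _ P _ X iX i (fun x => (x ^+ 2)%:E)).
- by apply: eq_integral => w _; rewrite expr2.
- by apply/measurable_EFinP; exact: measurable_funX.
- by move=> x; rewrite lee_fin sqr_ge0.
Qed.

Lemma has_mean_quadratic (a : R) (l : I -> R) (Q : I -> I -> R) :
  has_mean P (fun w => a + \sum_i l i * X i w + \sum_i \sum_j Q i j * (X i w * X j w))
    (a + var * \sum_i Q i i).
Proof.
have -> : a + var * \sum_i Q i i =
    a + \sum_i l i * 0 + \sum_i \sum_j Q i j * (if i == j then var else 0).
  rewrite [X in _ = _ + X + _]big1 ?addr0 => [|i _]; last by rewrite mulr0.
  congr (_ + _); rewrite mulr_sumr; apply: eq_bigr => i _.
  rewrite (bigD1 i)//= eqxx big1 ?addr0 1?mulrC// => j /negbTE.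
  by rewrite eq_sym => ->; rewrite mulr0.
apply: has_meanD; last first.
  by do 2 (apply: has_mean_sum => ?); apply: has_meanZ; exact: has_mean_coordM.
apply: has_meanD; first exact: has_mean_cst.
by apply: has_mean_sum => i; apply: has_meanZ; exact: has_mean_coord.
Qed.

Variable M : finType.

Definition lin (c : M -> I -> R) (z : I -> R) (m : M) : R := \sum_i c m i * z i.
(** The forms [lin c _ m] and [lin c _ m'], evaluated at the family [X], have covariance
    [var * cov c m m']. *)
Definition cov (c : M -> I -> R) (m m' : M) : R := \sum_i c m i * c m' i.

Lemma measurable_lin c m : measurable_fun setT (fun w => lin c (X^~ w) m).
Proof.
apply: measurable_sum => i; apply: measurable_funM => //; exact: measurable_cst.
Qed.

Lemma integrable_lin_cube c :
  P.-integrable setT (EFin \o (fun w => (\sum_m `|lin c (X^~ w) m|) ^+ 3)).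
Proof.
pose A := \sum_m \sum_i `|c m i|.
have A0 : 0 <= A by apply: sumr_ge0 => m _; apply: sumr_ge0.
have [B B0 hB] := sum_cube_le R (index_enum I).
apply: (integrable_cubic_growth iX (K := A ^+ 3 * B)).
  apply: measurable_funX; apply: measurable_sum => m.
  by apply: measurableT_comp => //; exact: measurable_lin.
move=> w; rewrite ger0_norm; last by rewrite exprn_ge0// sumr_ge0.
apply: (@le_trans _ _ (A ^+ 3 * (\sum_i `|X i w|) ^+ 3)).
  have s0 : 0 <= \sum_i `|X i w| by exact: sumr_ge0.
  rewrite -exprMn lerXn2r ?nnegrE ?(mulr_ge0 A0)//; first exact: sumr_ge0.
  rewrite /A mulr_suml ler_sum// => m _; rewrite mulr_suml.
  rewrite (le_trans (ler_norm_sum _ _ _))// ler_sum// => i _.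
  by rewrite normrM ler_wpM2l// (bigD1 i)//= lerDl sumr_ge0.
rewrite -[leRHS]mulrA ler_wpM2l ?exprn_ge0//.
rewrite (le_trans (hB _ _))// ler_wpM2l// lerDr//.
Qed.

(** Taking the mean of the Taylor polynomial kills the linear part and turns the quadratic part into
    covariances; the remainder is at most [C * eps^3] times the mean of the cubed sum of [|lin c|].
    The constant [K] is chosen before [F], [eps] and [z], because the exchange is repeated at random
    base points with shrinking steps. *)
Lemma mean_expansion (c : M -> I -> R) (C : R) : 0 <= C ->
  exists2 K, 0 <= K & forall (F : (M -> R) -> R) (eps : R) (z : M -> R) D H,
    (forall d (T : measurableType d) (Z : M -> T -> R),
      (forall m, measurable_fun setT (Z m)) -> measurable_fun setT (fun w => F (Z^~ w))) ->
    (forall y, 0 <= F y <= 1) -> 0 <= eps ->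
    (forall y, `|F (fun m => z m + y m) - F z - \sum_m D m * y m
       - \sum_m \sum_m' H m m' * (y m * y m')| <= C * (\sum_m `|y m|) ^+ 3) ->
    `|fine (\int[P]_w (F (fun m => z m + eps * lin c (X^~ w) m)%R)%:E)%E
      - (F z + var * (eps ^+ 2 * \sum_m \sum_m' H m m' * cov c m m'))| <= K * eps ^+ 3.
Proof.
move=> C0.
have hS := has_mean_fine (integrable_lin_cube c); set S := fine _ in hS.
have S0 : 0 <= S.
  apply: has_mean_le (has_mean_cst P 0) hS _ => w; by rewrite exprn_ge0// sumr_ge0.
exists (C * S); first by rewrite mulr_ge0.
move=> F eps z D H mF F01 e0 Fexp.
have hF := @has_mean_bounded _ _ _ P (fun w => F (fun m => z m + eps * lin c (X^~ w) m)).
have {}hF := hF _ (fun w => F01 _); set EF := fine _ in hF *.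
have {}hF : has_mean P (fun w => F (fun m => z m + eps * lin c (X^~ w) m)) EF.
  apply: hF; apply: (mF _ _ (fun m w => z m + eps * lin c (X^~ w) m)) => m.
  apply: measurable_funD => //; apply: measurable_funM; first exact: measurable_cst.
  exact: measurable_lin.
pose l i := eps * \sum_m D m * c m i.
pose Q i j := eps ^+ 2 * \sum_m \sum_m' H m m' * (c m i * c m' j).
have hq := has_mean_quadratic (F z) l Q; set q := (fun w => _) in hq.
(* Seen as a polynomial in the independent coordinates, the second-order term has mean [var] times
   the trace of [Q]. *)
have -> : eps ^+ 2 * \sum_m \sum_m' H m m' * cov c m m' = \sum_i Q i i.
  rewrite -mulr_sumr; congr (_ * _); rewrite [RHS]exchange_big /=; apply: eq_bigr => m _.
  by rewrite [RHS]exchange_big /=; apply: eq_bigr => m' _; rewrite mulr_sumr.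
set mq := F z + _ in hq *.
have hr w : `|F (fun m => z m + eps * lin c (X^~ w) m) - q w| <=
    C * eps ^+ 3 * (\sum_m `|lin c (X^~ w) m|) ^+ 3.
  have := Fexp (fun m => eps * lin c (X^~ w) m).
  have -> : \sum_m `|eps * lin c (X^~ w) m| = eps * \sum_m `|lin c (X^~ w) m|.
    by rewrite mulr_sumr; apply: eq_bigr => m _; rewrite normrM ger0_norm.
  rewrite exprMn mulrA; congr (`|_| <= _); rewrite /q !opprD !addrA; congr (_ - _ - _).
    rewrite /l; under [RHS]eq_bigr => i _ do rewrite -mulrA mulr_suml.
    rewrite -mulr_sumr exchange_big mulr_sumr; apply: eq_bigr => m _ /=.
    rewrite mulrCA; congr (_ * _); rewrite /lin mulr_sumr; apply: eq_bigr => i _.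
    by rewrite mulrA.
  rewrite /Q.
  transitivity (\sum_m \sum_m' \sum_i \sum_j
      eps ^+ 2 * (H m m' * (c m i * c m' j)) * (X i w * X j w)).
    apply: eq_bigr => m _; apply: eq_bigr => m' _.
    rewrite /lin mulrACA big_distrlr /= !mulr_sumr; apply: eq_bigr => i _.
    rewrite !mulr_sumr; apply: eq_bigr => j _; ring.
  under eq_bigr => m _ do rewrite exchange_big /=.
  rewrite exchange_big; apply: eq_bigr => i _ /=.
  under eq_bigr => m _ do rewrite exchange_big /=.
  rewrite exchange_big; apply: eq_bigr => j _ /=.
  rewrite mulr_sumr mulr_suml; apply: eq_bigr => m _.
  by rewrite mulr_sumr mulr_suml.
have hCS := has_meanZ (C * eps ^+ 3) hS.
rewrite ler_norml; apply/andP; split.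
- rewrite lerBrDl; have hN := has_meanD hq (has_meanZ (-1) hCS).
  rewrite [X in X <= _](_ : _ = mq + -1 * (C * eps ^+ 3 * S)); last by ring.
  apply: has_mean_le hN hF _ => w; have := hr w; rewrite ler_norml => /andP[+ _].
  by rewrite /=; lra.
- rewrite lerBlDl; have hN := has_meanD hq hCS.
  rewrite [X in _ <= X](_ : _ = mq + (C * eps ^+ 3 * S)); last by ring.
  apply: has_mean_le hF hN _ => w; have := hr w; rewrite ler_norml => /andP[_].
  by rewrite /=; lra.
Qed.

(** The two expansions share the term [F z], and the sign hypothesis orders the second-order terms
    entry by entry, so only the two cubic remainders are lost. *)
Lemma lindeberg_step (F : (M -> R) -> R) (cX cY : M -> I -> R) (C : R) : 0 <= C ->
  (forall d (T : measurableType d) (Z : M -> T -> R),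
    (forall m, measurable_fun setT (Z m)) -> measurable_fun setT (fun w => F (Z^~ w))) ->
  (forall y, 0 <= F y <= 1) ->
  (forall z, exists D, exists2 H,
    (forall m m', H m m' * (cov cY m m' - cov cX m m') <= 0) &
    (forall y, `|F (fun m => z m + y m) - F z - \sum_m D m * y m
       - \sum_m \sum_m' H m m' * (y m * y m')| <= C * (\sum_m `|y m|) ^+ 3)) ->
  exists2 K, 0 <= K & forall eps z, 0 <= eps ->
    (\int[P]_w (F (fun m => z m + eps * lin cY (X^~ w) m)%R)%:E <=
     \int[P]_w (F (fun m => z m + eps * lin cX (X^~ w) m)%R)%:E + (K * eps ^+ 3)%:E)%E.
Proof.
move=> C0 mF F01 Fexp.
have [KX KX0 hX] := mean_expansion cX C0; have [KY KY0 hY] := mean_expansion cY C0.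
exists (KX + KY); first exact: addr_ge0.
move=> eps z e0; have [D [H HH Hexp]] := Fexp z.
have {}hX := hX _ _ _ _ _ mF F01 e0 Hexp; have {}hY := hY _ _ _ _ _ mF F01 e0 Hexp.
have hF c : (\int[P]_w (F (fun m => z m + eps * lin c (X^~ w) m)%R)%:E =
    (fine (\int[P]_w (F (fun m => z m + eps * lin c (X^~ w) m)%R)%:E))%:E)%E.
  apply: (has_mean_bounded P (f := fun w => F (fun m => z m + eps * lin c (X^~ w) m)) _ _).2 => //.
  apply: (mF _ _ (fun m w => z m + eps * lin c (X^~ w) m)) => m.
  apply: measurable_funD => //; apply: measurable_funM; first exact: measurable_cst.
  exact: measurable_lin.
rewrite (hF cY) (hF cX) -EFinD lee_fin.
have : var * (eps ^+ 2 * \sum_m \sum_m' H m m' * cov cY m m') <=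
       var * (eps ^+ 2 * \sum_m \sum_m' H m m' * cov cX m m').
  rewrite ler_wpM2l// ler_wpM2l ?sqr_ge0// ler_sum// => m _; rewrite ler_sum// => m' _.
  by rewrite -subr_le0 -mulrBr.
move: hX hY; rewrite !ler_norml => /andP[hX1 hX2] /andP[hY1 hY2]; lra.
Qed.

End lindeberg.

(** * Telescoping the exchanges *)

Section gaussian_path.
Context {R : realType} d (T : measurableType d) (P : probability T R) (I M : finType).
Variables (X : I -> T -> R) (F : (M -> R) -> R) (cX cY : M -> I -> R) (K : R).
Hypothesis iX : iid_std_normal P X.
Hypothesis mF : forall d (T : measurableType d) (Z : M -> T -> R),
  (forall m, measurable_fun setT (Z m)) -> measurable_fun setT (fun w => F (Z^~ w)).
Hypothesis F0 : forall y, 0 <= F y.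
Hypothesis K0 : 0 <= K.
Hypothesis step : forall eps z, 0 <= eps ->
  (\int[P]_w (F (fun m => z m + eps * lin cY (X^~ w) m)%R)%:E <=
   \int[P]_w (F (fun m => z m + eps * lin cX (X^~ w) m)%R)%:E + (K * eps ^+ 3)%:E)%E.

Let mX i : measurable_fun setT (X i). Proof. by case: iX. Qed.

Let linD (c : M -> I -> R) (z z' : I -> R) a b m :
  lin c (fun i => b * z i + a * z' i) m = b * lin c z m + a * lin c z' m :> R.
Proof.
rewrite /lin !mulr_sumr -big_split; apply: eq_bigr => i _ /=; ring.
Qed.

Let linZ (c : M -> I -> R) (z : I -> R) a m : lin c (fun i => a * z i) m = a * lin c z m :> R.
Proof. by rewrite /lin mulr_sumr; apply: eq_bigr => i _ /=; rewrite mulrCA. Qed.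

(* Splitting the independent copy [c' X] into [b X + eps X'] merges two increments into one. *)
Let merge (c : M -> I -> R) (z : M -> R) (eps b c' : R) :
  0 < eps -> 0 <= c' -> c' ^+ 2 = b ^+ 2 + eps ^+ 2 ->
  (\int[P]_x (F (fun m => z m + c' * lin c (X^~ x) m)%R)%:E =
   \int[P]_x \int[P]_y (F (fun m => z m + b * lin c (X^~ x) m
                                      + eps * lin c (X^~ y) m)%R)%:E)%E.
Proof.
move=> e0 c0 cE; rewrite addrC in cE.
pose f (u : I -> R) := (F (fun m => z m + lin c u m))%:E.
have mf : coord_measurable f.
  move=> d0 T0 Z mZ; apply/measurable_EFinP.
  apply: (mF (Z := fun m w => z m + lin c (Z^~ w) m)) => m.
  apply: measurable_funD => //.
  by apply: measurable_sum => i; apply: measurable_funM => //; exact: measurable_cst.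
have f0 u : (0 <= f u)%E by rewrite lee_fin.
have := iid_integral_stable e0 c0 cE iX iX iX mf f0; rewrite /f.
under eq_integral => w _ do under eq_fun do rewrite linZ.
move=> ->; apply: eq_integral => x _; apply: eq_integral => y _.
by congr (F _)%:E; apply/funext => m; rewrite linD addrA.
Qed.

(** The mean of [F] at [a X + b Y] with [X] and [Y] built from independent copies of the normals;
    the path runs from [u 1 0] to [u 0 1]. *)
Let u (a b : R) : \bar R :=
  (\int[P]_x \int[P]_y (F (fun m => a * lin cX (X^~ x) m + b * lin cY (X^~ y) m)%R)%:E)%E.

Let mlin (c : M -> I -> R) m d' (T' : measurableType d') (g : T' -> T) : measurable_fun setT g ->
  measurable_fun setT (fun w => lin c (X^~ (g w)) m).
Proof. by move=> mg; exact: (measurableT_comp (measurable_lin iX c m) mg). Qed.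

(** Both sides share [a X + b Y] and carry one further increment of size [eps] from a third copy: of
    type [Y] it merges [b] into [b'], of type [X] it merges [a] into [a']. For fixed [x] and [y]
    these two increments are compared by [step]. *)
Let u_step (a b a' b' eps : R) : 0 < eps -> 0 <= a' -> 0 <= b' ->
  a' ^+ 2 = a ^+ 2 + eps ^+ 2 -> b' ^+ 2 = b ^+ 2 + eps ^+ 2 ->
  (u a b' <= u a' b + (K * eps ^+ 3)%:E)%E.
Proof.
move=> e0 a'0 b'0 aE bE.
pose G (c : M -> I -> R) (xyw : (T * T) * T) : \bar R :=
  (F (fun m => a * lin cX (X^~ xyw.1.1) m + b * lin cY (X^~ xyw.1.2) m
               + eps * lin c (X^~ xyw.2) m))%:E.
have mG c : measurable_fun setT (G c).
  apply/measurable_EFinP; apply: (mF (Z := fun m xyw => a * lin cX (X^~ xyw.1.1) m +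
    b * lin cY (X^~ xyw.1.2) m + eps * lin c (X^~ xyw.2) m)) => m.
  apply: measurable_funD; first apply: measurable_funD;
    apply: measurable_funM; do ?exact: measurable_cst; apply: mlin => //.
  - by apply: measurableT_comp.
  - by apply: measurableT_comp.
have G0 c z : (0 <= G c z)%E by rewrite lee_fin.
have mH c := measurable_integral_snd P (mG c) (G0 c).
have H0 c (z : T * T) : (0 <= \int[P]_w G c (z, w))%E by exact: integral_ge0.
have mHx c x : measurable_fun setT (fun y => \int[P]_w G c ((x, y), w))%E.
  exact: (measurableT_comp (mH c) (pair1_measurable x)).
have -> : u a b' = (\int[P]_x \int[P]_y \int[P]_w G cY ((x, y), w))%E.
  by apply: eq_integral => x _; exact: merge.
have -> : u a' b = (\int[P]_x \int[P]_y \int[P]_w G cX ((x, y), w))%E.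
  (* The variable to be merged is the outer one here, so both sides are swapped and [x] is treated
     for fixed [y]. *)
  rewrite /u (ge0_integral_swap P P (f := fun xy : T * T => (F (fun m =>
    a' * lin cX (X^~ xy.1) m + b * lin cY (X^~ xy.2) m))%:E)); last 2 first.
  - apply/measurable_EFinP; apply: (mF (Z := fun m (xy : T * T) =>
      a' * lin cX (X^~ xy.1) m + b * lin cY (X^~ xy.2) m)) => m.
    by apply: measurable_funD; apply: measurable_funM; do ?exact: measurable_cst; apply: mlin.
  - by move=> z; rewrite lee_fin.
  rewrite (ge0_integral_swap P P (mH cX) (H0 cX)).
  apply: eq_integral => y _ /=.
  have := merge cX (fun m => b * lin cY (X^~ y) m) e0 a'0 aE.
  under eq_integral => w _ do under eq_fun do rewrite addrC.
  move=> ->; apply: eq_integral => x _; apply: eq_integral => w _.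
  by congr (F _)%:E; apply/funext => m /=; rewrite [b * _ + _]addrC.
have Ke : 0 <= K * eps ^+ 3 by rewrite mulr_ge0// exprn_ge0// ltW.
have int_cst d' (T' : measurableType d') (Q : probability T' R) (f : T' -> \bar R) :
    measurable_fun setT f -> (forall x, 0 <= f x)%E ->
    (\int[Q]_x (f x + (K * eps ^+ 3)%:E) = \int[Q]_x f x + (K * eps ^+ 3)%:E)%E.
  move=> mf f0; rewrite ge0_integralD//= integral_cst//.
  by rewrite [X in (_ + _ * X)%E](@probability_setT _ _ _ Q) mule1.
apply: (@le_trans _ _ (\int[P]_x (\int[P]_y \int[P]_w G cX ((x, y), w)
                          + (K * eps ^+ 3)%:E))%E); last first.
  rewrite int_cst//; last by move=> x; exact: integral_ge0.
  exact: (measurable_integral_snd P (mH cX) (H0 cX)).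
apply: ge0_le_integral => //.
- by move=> x _; exact: integral_ge0.
- exact: (measurable_integral_snd P (mH cY) (H0 cY)).
- apply: emeasurable_funD; last exact: measurable_cst.
  exact: (measurable_integral_snd P (mH cX) (H0 cX)).
move=> x _; rewrite -int_cst//.
apply: ge0_le_integral => //.
- by apply: emeasurable_funD => //; exact: measurable_cst.
- move=> y _; rewrite /G /=.
  exact: (step (fun m => a * lin cX (X^~ x) m + b * lin cY (X^~ y) m) (ltW e0)).
Qed.

Lemma gaussian_path_le :
  (\int[P]_w (F (lin cY (X^~ w)))%:E <= \int[P]_w (F (lin cX (X^~ w)))%:E)%E.
Proof.
have u01 : u 0 1 = (\int[P]_w (F (lin cY (X^~ w)))%:E)%E.
  transitivity (\int[P]_(x in setT) \int[P]_w (F (lin cY (X^~ w)))%:E)%E.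
    apply: eq_integral => x _; apply: eq_integral => y _.
    by congr (F _)%:E; apply/funext => m; rewrite mul0r add0r mul1r.
  by rewrite integral_cst// [X in (_ * X)%E](@probability_setT _ _ _ P) mule1.
have u10 : u 1 0 = (\int[P]_w (F (lin cX (X^~ w)))%:E)%E.
  apply: eq_integral => x _.
  transitivity (\int[P]_(y in setT) (F (lin cX (X^~ x)))%:E)%E.
    apply: eq_integral => y _.
    by congr (F _)%:E; apply/funext => m; rewrite mul0r addr0 mul1r.
  by rewrite integral_cst// [X in (_ * X)%E](@probability_setT _ _ _ P) mule1.
rewrite -u01 -u10.
(* After [k] exchanges [Y] carries the fraction [k / N] of the variance and [X] the rest; each
   exchange costs [K * N^(-3/2)]. *)
have uN (N k : nat) : (0 < N)%N -> (k <= N)%N ->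
    (u (Num.sqrt (1 - k%:R / N%:R)) (Num.sqrt (k%:R / N%:R)) <=
     u 1 0 + (k%:R * (K * Num.sqrt (N%:R^-1) ^+ 3))%:E)%E.
  move=> N0; have Np : 0 < N%:R :> R by rewrite ltr0n.
  elim: k => [_|k IH kN].
    by rewrite mul0r subr0 sqrtr1 sqrtr0 mul0r adde0.
  have kN' : k.+1%:R / N%:R <= 1 :> R by rewrite ler_pdivrMr// mul1r ler_nat.
  have e0 : 0 < Num.sqrt (N%:R^-1) :> R by rewrite sqrtr_gt0 invr_gt0.
  have kk : k.+1%:R / N%:R = k%:R / N%:R + N%:R^-1 :> R.
    by rewrite -natr1 mulrDl mul1r.
  have k0 : 0 <= k%:R / N%:R :> R by rewrite divr_ge0.
  have N'0 : 0 <= N%:R^-1 :> R by rewrite invr_ge0 ltW.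
  have := u_step (a := Num.sqrt (1 - k.+1%:R / N%:R)) (b := Num.sqrt (k%:R / N%:R))
    (a' := Num.sqrt (1 - k%:R / N%:R)) (b' := Num.sqrt (k.+1%:R / N%:R)) e0.
  have h1 : 0 <= 1 - k.+1%:R / N%:R :> R by lra.
  have h2 : 0 <= 1 - k%:R / N%:R :> R by lra.
  have h3 : 0 <= k.+1%:R / N%:R :> R by lra.
  rewrite !sqr_sqrtr// => /(_ (sqrtr_ge0 _) (sqrtr_ge0 _)) h.
  apply: (le_trans (h _ _)); [by lra|by lra|].
  rewrite -[in leRHS]natr1 mulrDl mul1r EFinD addeA leeD2r//.
  by apply: IH; exact: ltnW.
apply/lee_addgt0Pr => e e0.
(* The total cost [K / sqrt N] is at most [e] as soon as [N >= (K / e)^2]. *)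
pose N := (Num.truncn ((K / e) ^+ 2)).+1.
have Np : 0 < N%:R :> R by rewrite ltr0n.
have := uN N N isT (leqnn N); rewrite divff ?gt_eqF// subrr sqrtr0 sqrtr1.
move=> /le_trans; apply; rewrite leeD2l// lee_fin.
set s := Num.sqrt _; have s0 : 0 < s by rewrite sqrtr_gt0 invr_gt0.
have sN : s ^+ 2 = N%:R^-1 by rewrite sqr_sqrtr// invr_ge0 ltW.
have -> : N%:R * (K * s ^+ 3) = K * s.
  by rewrite exprS sN; field; rewrite gt_eqF.
have KN : (K / e) ^+ 2 <= N%:R by rewrite ltW// truncnS_gt.
have : (K * s) ^+ 2 <= e ^+ 2.
  rewrite exprMn sN ler_pdivrMr//.
  by move: KN; rewrite expr_div_n ler_pdivrMr ?exprn_gt0// mulrC.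
by rewrite ler_sqr// ?nnegrE ?mulr_ge0// ltW.
Qed.

End gaussian_path.

(** * Smooth approximation of min-max events *)

Section logistic.
Context {R : realType}.

(** The mean value theorem is used in place of integration; it gives up the factor [1 / (n + 1)]. *)
Lemma le_pow_of_derive (g g' : R -> R) (C : R) (n : nat) : 0 <= C ->
  (forall x : R, is_derive x 1 g (g' x)) -> (forall x, `|g' x| <= C * `|x| ^+ n) ->
  g 0 = 0 -> forall x, `|g x| <= C * `|x| ^+ n.+1.
Proof.
move=> C0 dg g'C g0 x.
have cg : continuous g.
  by move=> y; apply/differentiable_continuous/derivable1_diffP; case: (dg y).
(* Treats the segments from 0 to [x] and from [x] to 0 together. *)
have key (a b c : R) : c \in `[a, b] -> (a = 0 /\ b = x) \/ (a = x /\ b = 0) ->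
    g b - g a = g' c * (b - a) -> `|g x| <= C * `|x| ^+ n.+1.
  move=> cab abx /(congr1 (fun u => `|u|)).
  have cx : `|c| <= `|x|.
    move: cab; rewrite in_itv /= => /andP[ac cb].
    case: abx => -[ea eb]; move: ac cb; rewrite ea eb => ac cb.
      by rewrite !ger0_norm// (le_trans ac).
    by rewrite !ler0_norm ?lerN2// (le_trans ac).
  have -> : `|g b - g a| = `|g x|.
    by case: abx => -[-> ->]; rewrite g0 ?subr0// sub0r normrN.
  rewrite normrM; have -> : `|b - a| = `|x|.
    by case: abx => -[-> ->]; rewrite ?subr0// sub0r normrN.
  move=> ->; rewrite exprSr mulrA ler_wpM2r//.
  by rewrite (le_trans (g'C c))// ler_wpM2l// lerXn2r ?nnegrE.
have [x0|/ltW x0] := leP 0 x.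
  have [c cx E] := MVT_segment x0 (fun y _ => dg y) (continuous_subspaceT cg).
  by apply: (key 0 x c) => //; left.
have [c cx E] := MVT_segment x0 (fun y _ => dg y) (continuous_subspaceT cg).
by apply: (key x 0 c) => //; right.
Qed.

(** A decreasing step with exponential tails on both sides whose derivatives are polynomials in its
    own value, hence bounded on the whole line. *)
Definition logistic (x : R) : R := (1 + expR x)^-1.

Lemma logistic_ge0 x : 0 <= logistic x.
Proof. by rewrite invr_ge0 addr_ge0// expR_ge0. Qed.

Lemma logistic_le1 x : logistic x <= 1.
Proof. by rewrite invf_le1 ?ltr_pwDl ?expR_ge0// lerDl expR_ge0. Qed.

Lemma logistic_le_expRN x : logistic x <= expR (- x).
Proof.
rewrite expRN lef_pV2 ?posrE ?expR_gt0 ?ltr_pwDl ?expR_ge0//.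
by rewrite lerDr.
Qed.

Lemma logistic_ge_expR x : 1 - expR x <= logistic x.
Proof.
have e0 : 0 <= expR x by exact: expR_ge0.
rewrite /logistic -[X in _ <= X]mul1r ler_pdivlMr ?ltr_pwDl//; nra.
Qed.

Lemma measurable_logistic : measurable_fun setT logistic.
Proof.
apply: continuous_measurable_fun => x; apply: cvgV.
  by rewrite gt_eqF// ltr_pwDl ?expR_ge0.
by apply: cvgD; [exact: cvg_cst|exact: continuous_expR].
Qed.

Let c1 x := - (logistic x * (1 - logistic x)).
Let c2 x := logistic x * (1 - logistic x) * (1 - 2 * logistic x).
Let c3 x := c1 x * (1 - 6 * logistic x + 6 * logistic x ^+ 2).

Let dc0 (x : R) : is_derive x 1 logistic (c1 x).
Proof.
have n0 : 1 + expR x != 0 by rewrite gt_eqF// ltr_pwDl ?expR_ge0.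
have h : is_derive x 1 (fun y : R => 1 + expR y) (expR x).
  by apply: is_derive_eq; rewrite add0r mul1r.
have h' := @is_deriveV _ (fun y : R => 1 + expR y) x _ _ n0 h.
rewrite /logistic; apply: (is_derive_eq h').
by rewrite /c1 /logistic /GRing.scale /=; field.
Qed.

Let dc1 (x : R) : is_derive x 1 c1 (c2 x).
Proof.
have h := dc0 x; rewrite /c1; apply: is_derive_eq.
by rewrite /c2 /c1 /GRing.scale /=; ring.
Qed.

Let dc2 (x : R) : is_derive x 1 c2 (c3 x).
Proof.
have h := dc0 x; rewrite /c2; apply: is_derive_eq.
by rewrite /c3 /c1 /GRing.scale /=; ring.
Qed.

Let dshift (f f' : R -> R) (a y : R) : (forall x : R, is_derive x 1 f (f' x)) ->
  is_derive y 1 (fun y => f (a + y)) (f' (a + y)).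
Proof.
move=> df; have h := df (a + y).
have h1 : is_derive y 1 (fun y : R => a + y) 1.
  by apply: is_derive_eq (is_deriveD (is_derive_cst a y 1) (is_derive_id y 1)) _; rewrite add0r.
by have := @is_derive1_comp _ f (fun y => a + y) y _ _ h h1; rewrite mulr1.
Qed.

Let bound x : [/\ c1 x <= 0, `|c1 x| <= 1, `|c2 x| <= 1 & `|c3 x| <= 1].
Proof.
rewrite /c3 /c2 /c1; have := logistic_ge0 x; have := logistic_le1 x.
move: (logistic x) => p p1 p0; have q0 : 0 <= 1 - p by rewrite subr_ge0.
have pq := mulr_ge0 p0 q0.
have pq1 : p * (1 - p) <= 1 by nra.
have r1 : `|1 - 2 * p| <= 1 by rewrite ler_norml; apply/andP; split; lra.
have r2 : `|1 - 6 * p + 6 * p ^+ 2| <= 1 by rewrite ler_norml; apply/andP; split; nra.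
split; first by rewrite oppr_le0.
- by rewrite normrN ger0_norm.
- by rewrite normrM [`|p * _|]ger0_norm// mulr_ile1.
- by rewrite normrM normrN [`|p * _|]ger0_norm// mulr_ile1.
Qed.

(** The bound [|c3| <= 1] is integrated three times with [le_pow_of_derive]. The sign of [D] is
    recorded because it decides the sign of the mixed derivatives of the smoothed event. *)
Lemma logistic_taylor x : exists D H, [/\ D <= 0, `|D| <= 1, `|H| <= 1 &
  forall y, `|logistic (x + y) - logistic x - D * y - H * y ^+ 2| <= `|y| ^+ 3].
Proof.
have [b1 b2 b3 _] := bound x.
exists (c1 x), (c2 x / 2); split => //.
  by rewrite normrM (ger0_norm (_ : 0 <= 2^-1))//; lra.
have g2 y : `|c2 (x + y) - c2 x| <= 1 * `|y| ^+ 1.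
  apply: (@le_pow_of_derive (fun y => c2 (x + y) - c2 x) (fun y => c3 (x + y))) => //.
  - move=> z; have h := dshift x z dc2; apply: is_derive_eq; by rewrite subr0.
  - by move=> z; rewrite expr0 mulr1; have [] := bound (x + z).
  - by rewrite addr0 subrr.
have g1 y : `|c1 (x + y) - c1 x - c2 x * y| <= 1 * `|y| ^+ 2.
  apply: (@le_pow_of_derive (fun y => c1 (x + y) - c1 x - c2 x * y)
    (fun y => c2 (x + y) - c2 x)) => //.
  - move=> z; have h := dshift x z dc1; apply: is_derive_eq.
    by rewrite /GRing.scale /=; ring.
  - by rewrite addr0 subrr mulr0 subr0.
move=> y; rewrite -[leRHS]mul1r.
apply: (@le_pow_of_derive (fun y => logistic (x + y) - logistic x - c1 x * y - c2 x / 2 * y ^+ 2)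
    (fun y => c1 (x + y) - c1 x - c2 x * y)) => //.
- move=> z; have h := dshift x z dc0; apply: is_derive_eq.
  by rewrite /GRing.scale /=; field.
- by rewrite addr0 subrr mulr0 subr0 expr0n mulr0 subr0.
Qed.

End logistic.

Section smooth3.
Context {R : realType} {M : finType}.
Implicit Types (f g : (M -> R) -> R) (D : M -> R) (H : M -> M -> R)
  (S : (M -> R) -> (M -> M -> R) -> Prop).

(* [S] records sign and support information on the gradient [D] and the (halved,
   not necessarily symmetric) Hessian [H] at every point. *)
Definition smooth3 S f :=
  (forall y, 0 <= f y <= 1) /\
  exists2 C, 0 <= C & forall z, exists D, exists H,
    [/\ S D H, forall m, `|D m| <= C, forall m m', `|H m m'| <= C &
     forall y, `|f (fun m => z m + y m) - f z - \sum_m D m * y m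
       - \sum_m \sum_m' H m m' * (y m * y m')| <= C * (\sum_m `|y m|) ^+ 3].

Let linear_le D (C : R) (y : M -> R) : (forall m, `|D m| <= C) ->
  `|\sum_m D m * y m| <= C * \sum_m `|y m|.
Proof.
move=> DC; rewrite (le_trans (ler_norm_sum _ _ _))// mulr_sumr ler_sum// => m _.
by rewrite normrM ler_wpM2r.
Qed.

Let quadratic_le H (C : R) (y : M -> R) : (forall m m', `|H m m'| <= C) ->
  `|\sum_m \sum_m' H m m' * (y m * y m')| <= C * (\sum_m `|y m|) ^+ 2.
Proof.
move=> HC; rewrite (le_trans (ler_norm_sum _ _ _))//.
rewrite expr2 mulr_suml mulr_sumr ler_sum// => m _.
rewrite (le_trans (ler_norm_sum _ _ _))// mulr_sumr mulr_sumr ler_sum// => m' _.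
by rewrite !normrM ler_wpM2r// mulr_ge0.
Qed.

(** Here [N] is the size of the increment. For [N <= 1] the remainder of the product is a sum of
    seven terms of order at least three; five of them carry [C1 * C2], hence the 5. For [N > 1]
    every term is bounded separately using [N^k <= N^3], and the 1 pays for [f1 * g1 - f0 * g0]. *)
Let taylor_mul (C1 C2 N f0 f1 g0 g1 p q p' q' : R) : 0 <= C1 -> 0 <= C2 -> 0 <= N ->
  0 <= f0 <= 1 -> 0 <= f1 <= 1 -> 0 <= g0 <= 1 -> 0 <= g1 <= 1 ->
  `|p| <= C1 * N -> `|q| <= C1 * N ^+ 2 -> `|p'| <= C2 * N -> `|q'| <= C2 * N ^+ 2 ->
  `|f1 - f0 - p - q| <= C1 * N ^+ 3 -> `|g1 - g0 - p' - q'| <= C2 * N ^+ 3 ->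
  `|f1 * g1 - f0 * g0 - (f0 * p' + g0 * p) - (f0 * q' + g0 * q + p * p')| <=
    (1 + 2 * C1 + 2 * C2 + 5 * (C1 * C2)) * N ^+ 3.
Proof.
move=> C10 C20 N0 f0b f1b g0b g1b hp hq hp' hq' hr hr'.
have C120 := mulr_ge0 C10 C20.
have N30 : 0 <= N ^+ 3 by rewrite exprn_ge0.
have C1N := mulr_ge0 C10 N30; have C2N := mulr_ge0 C20 N30.
have C12N := mulr_ge0 C120 N30.
have prod_le (a b A B : R) : `|a| <= A -> `|b| <= B -> `|a * b| <= A * B.
  by move=> aA bB; rewrite normrM ler_pM.
have unit_le (x : R) : 0 <= x <= 1 -> `|x| <= 1.
  by move=> /andP[? ?]; rewrite ger0_norm.
have f0n := unit_le _ f0b; have g0n := unit_le _ g0b; have g1n := unit_le _ g1b.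
have [N1|N1] := leP N 1.
  have pow_le k : (3 <= k)%N -> N ^+ k <= N ^+ 3.
    by move=> k3; rewrite -(subnK k3) exprD ler_piMl// exprn_ile1.
  have N4 := ler_wpM2l C120 (pow_le 4 isT).
  have N5 := ler_wpM2l C120 (pow_le 5 isT).
  have -> : f1 * g1 - f0 * g0 - (f0 * p' + g0 * p) - (f0 * q' + g0 * q + p * p') =
      p * q' + q * p' + q * q' + (f1 - f0 - p - q) * g1 +
      f0 * (g1 - g0 - p' - q') + p * (g1 - g0 - p' - q') + q * (g1 - g0 - p' - q').
    by ring.
  have := prod_le _ _ _ _ hp hq'; have := prod_le _ _ _ _ hq hp'.
  have := prod_le _ _ _ _ hq hq'; have := prod_le _ _ _ _ hr g1n.
  have := prod_le _ _ _ _ f0n hr'; have := prod_le _ _ _ _ hp hr'.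
  have := prod_le _ _ _ _ hq hr'.
  rewrite !ler_norml; move: (p * q') (q * p') (q * q') (_ * g1) (f0 * _) (p * _) (q * _).
  move=> x1 x2 x3 x4 x5 x6 x7.
  move=> /andP[? ?] /andP[? ?] /andP[? ?] /andP[? ?] /andP[? ?] /andP[? ?] /andP[? ?].
  by apply/andP; split; lra.
have pow_le k : (k <= 3)%N -> N ^+ k <= N ^+ 3.
  by move=> k3; rewrite ler_weXn2l// ltW.
have N1C1 := ler_wpM2l C10 (pow_le 1 isT); have N2C1 := ler_wpM2l C10 (pow_le 2 isT).
have N1C2 := ler_wpM2l C20 (pow_le 1 isT); have N2C2 := ler_wpM2l C20 (pow_le 2 isT).
have N2C12 := ler_wpM2l C120 (pow_le 2 isT); have N13 := pow_le 0 isT.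
have : -1 <= f1 * g1 - f0 * g0 <= 1.
  move: f0b f1b g0b g1b => /andP[? ?] /andP[? ?] /andP[? ?] /andP[? ?].
  by apply/andP; split; nra.
have := prod_le _ _ _ _ f0n hp'; have := prod_le _ _ _ _ g0n hp.
have := prod_le _ _ _ _ f0n hq'; have := prod_le _ _ _ _ g0n hq.
have := prod_le _ _ _ _ hp hp'.
rewrite !ler_norml; move: (p * p') (g0 * q) (f0 * q') (g0 * p) (f0 * p') (_ - _ * g0).
move=> x1 x2 x3 x4 x5 x6.
move=> /andP[? ?] /andP[? ?] /andP[? ?] /andP[? ?] /andP[? ?] /andP[? ?].
by apply/andP; split; lra.
Qed.

(** The hypothesis on [S] is the Leibniz rule. The cross term [D1 m * D2 m'] is left unsymmetrised,
    which yields the same quadratic form. *)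
Lemma smooth3M S1 S2 S f g :
  (forall a b D1 H1 D2 H2, 0 <= a -> 0 <= b -> S1 D1 H1 -> S2 D2 H2 ->
     S (fun m => a * D2 m + b * D1 m)
       (fun m m' => a * H2 m m' + b * H1 m m' + D1 m * D2 m')) ->
  smooth3 S1 f -> smooth3 S2 g -> smooth3 S (fun y => f y * g y).
Proof.
move=> SM [f01 [C1 C10 fexp]] [g01 [C2 C20 gexp]].
have C120 := mulr_ge0 C10 C20.
split=> [y|].
  by have /andP[? ?] := f01 y; have /andP[? ?] := g01 y; rewrite mulr_ge0//= mulr_ile1.
exists (1 + 2 * C1 + 2 * C2 + 5 * (C1 * C2)); first by lra.
move=> z; have [D1 [H1 [S1z D1C H1C E1]]] := fexp z.
have [D2 [H2 [S2z D2C H2C E2]]] := gexp z.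
have /andP[fz0 fz1] := f01 z; have /andP[gz0 gz1] := g01 z.
have DD (a b A B : R) : 0 <= a -> a <= 1 -> `|b| <= B -> `|a * b| <= B.
  move=> a0 a1 bB; rewrite normrM ger0_norm//.
  by rewrite (le_trans _ bB)// ler_piMl.
exists (fun m => f z * D2 m + g z * D1 m).
exists (fun m m' => f z * H2 m m' + g z * H1 m m' + D1 m * D2 m'); split.
- exact: SM.
- move=> m; rewrite (le_trans (ler_normD _ _))//.
  have := DD _ _ 1 _ fz0 fz1 (D2C m); have := DD _ _ 1 _ gz0 gz1 (D1C m); lra.
- move=> m m'; rewrite (le_trans (ler_normD _ _))//.
  have := ler_normD (f z * H2 m m') (g z * H1 m m').
  have := DD _ _ 1 _ fz0 fz1 (H2C m m'); have := DD _ _ 1 _ gz0 gz1 (H1C m m').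
  have : `|D1 m * D2 m'| <= C1 * C2 by rewrite normrM ler_pM.
  lra.
move=> y.
have -> : \sum_m (f z * D2 m + g z * D1 m) * y m =
    f z * (\sum_m D2 m * y m) + g z * \sum_m D1 m * y m.
  by rewrite !mulr_sumr -big_split; apply: eq_bigr => m _ /=; ring.
have -> : \sum_m \sum_m' (f z * H2 m m' + g z * H1 m m' + D1 m * D2 m') * (y m * y m') =
    f z * (\sum_m \sum_m' H2 m m' * (y m * y m')) +
    g z * (\sum_m \sum_m' H1 m m' * (y m * y m')) +
    (\sum_m D1 m * y m) * \sum_m D2 m * y m.
  rewrite big_distrlr /= !mulr_sumr -!big_split; apply: eq_bigr => m _ /=.
  by rewrite !mulr_sumr -!big_split; apply: eq_bigr => m' _ /=; ring.
by apply: taylor_mul => //; [exact: sumr_ge0|exact: linear_le|exact: quadratic_le|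
  exact: linear_le|exact: quadratic_le].
Qed.

Lemma smooth3_onem S S' f :
  (forall D H, S D H -> S' (fun m => - D m) (fun m m' => - H m m')) ->
  smooth3 S f -> smooth3 S' (fun y => 1 - f y).
Proof.
move=> SN [f01 [C C0 fexp]]; split=> [y|].
  by have /andP[? ?] := f01 y; rewrite subr_ge0 lerBlDr lerDl; apply/andP.
exists C => // z; have [D [H [Sz DC HC E]]] := fexp z.
exists (fun m => - D m), (fun m m' => - H m m'); split => //.
- exact: SN.
- by move=> m; rewrite normrN.
- by move=> m m'; rewrite normrN.
move=> y; rewrite -normrN (le_trans _ (E y))// le_eqVlt; apply/orP; left; apply/eqP.
congr `|_|; under eq_bigr do rewrite mulNr.
under [X in _ - X]eq_bigr do (under eq_bigr do rewrite mulNr).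
under [X in _ - X]eq_bigr do rewrite sumrN.
by rewrite !sumrN; ring.
Qed.

Lemma smooth3_weaken S S' f : (forall D H, S D H -> S' D H) ->
  smooth3 S f -> smooth3 S' f.
Proof.
move=> SS' [f01 [C C0 fexp]]; split => //; exists C => // z.
by have [D [H [? ? ? ?]]] := fexp z; exists D, H; split => //; exact: SS'.
Qed.

Lemma smooth3_prod S (J : Type) (s : seq J) (f : J -> (M -> R) -> R) :
  S (fun=> 0) (fun _ _ => 0) ->
  (forall a b D1 H1 D2 H2, 0 <= a -> 0 <= b -> S D1 H1 -> S D2 H2 ->
     S (fun m => a * D2 m + b * D1 m)
       (fun m m' => a * H2 m m' + b * H1 m m' + D1 m * D2 m')) ->
  (forall j, smooth3 S (f j)) -> smooth3 S (fun y => \prod_(j <- s) f j y).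
Proof.
move=> S0 SM fS; elim: s => [|j s IH].
  split=> [y|]; first by rewrite big_nil ler01 lexx.
  exists 0 => // z; exists (fun=> 0), (fun _ _ => 0); split => // [m|m m'|y].
  - by rewrite normr0.
  - by rewrite normr0.
  - rewrite !big_nil subrr sub0r big1 => [|m _]; last by rewrite mul0r.
    rewrite big1 => [|m _]; last by rewrite big1 => // m' _; rewrite mul0r.
    by rewrite oppr0 addr0 normr0 mul0r.
rewrite (_ : (fun y => _) = (fun y => f j y * \prod_(j <- s) f j y)).
  exact: (smooth3M SM (fS j) IH).
by apply/funext => y; rewrite big_cons.
Qed.

Lemma smooth3_logistic (la r : R) (m0 : M) : 0 <= la ->
  smooth3 (fun D H => [/\ forall m, D m <= 0, forall m, m != m0 -> D m = 0 &
      forall m m', (m != m0) || (m' != m0) -> H m m' = 0])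
    (fun y => logistic (la * (y m0 - r))).
Proof.
move=> la0; split=> [y|]; first by rewrite logistic_ge0 logistic_le1.
(* The three summands bound gradient, Hessian and remainder in turn. *)
exists (la + la ^+ 2 + la ^+ 3); first by rewrite !addr_ge0// exprn_ge0.
have la2 : 0 <= la ^+ 2 by rewrite exprn_ge0.
have la3 : 0 <= la ^+ 3 by rewrite exprn_ge0.
move=> z; have [D [H [D0 D1 H1 E]]] := logistic_taylor (la * (z m0 - r)).
exists (fun m => if m == m0 then la * D else 0).
exists (fun m m' => if (m == m0) && (m' == m0) then la ^+ 2 * H else 0); split.
- split=> [m|m /negbTE ->//|m m'].
    by case: eqP => // _; rewrite mulr_ge0_le0.
  by rewrite -negb_and => /negbTE ->.
- move=> m; case: eqP => _; last by rewrite normr0; lra.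
  rewrite normrM ger0_norm//; have : la * `|D| <= la * 1 by rewrite ler_wpM2l.
  lra.
- move=> m m'; case: ifP => _; last by rewrite normr0; lra.
  rewrite normrM ger0_norm//; have : la ^+ 2 * `|H| <= la ^+ 2 * 1 by rewrite ler_wpM2l.
  lra.
move=> y; have := E (la * y m0).
have -> : la * (z m0 - r) + la * y m0 = la * (z m0 + y m0 - r) by ring.
have -> : \sum_m (if m == m0 then la * D else 0) * y m = D * (la * y m0).
  rewrite (bigD1 m0)//= eqxx big1 ?addr0 => [|m /negbTE ->]; last by rewrite mul0r.
  by ring.
have -> : \sum_m \sum_m' (if (m == m0) && (m' == m0) then la ^+ 2 * H else 0) * (y m * y m') =
    H * (la * y m0) ^+ 2.
  rewrite (bigD1 m0)//= eqxx /= [X in _ + X]big1 ?addr0; last first.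
    by move=> m /negbTE ->; rewrite big1// => m' _; rewrite mul0r.
  rewrite (bigD1 m0)//= eqxx big1 ?addr0 => [|m /negbTE ->]; last by rewrite mul0r.
  by ring.
move=> h; apply: (le_trans h).
rewrite normrM exprMn ger0_norm//.
have y0 : `|y m0| <= \sum_m `|y m| by rewrite (bigD1 m0)//= lerDl sumr_ge0.
have : `|y m0| ^+ 3 <= (\sum_m `|y m|) ^+ 3.
  by rewrite lerXn2r ?nnegrE ?sumr_ge0.
move=> /(ler_wpM2l la3) /le_trans; apply; rewrite ler_wpM2r ?exprn_ge0 ?sumr_ge0//.
lra.
Qed.

End smooth3.

Section minmax_smoothing.
Context {R : realType} {W V : finType}.

Definition smooth_minmax (la : R) (r : W * V -> R) (z : W * V -> R) : R :=
  1 - \prod_w (1 - \prod_v logistic (la * (z (w, v) - r (w, v)))).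

(** Signs are followed from the inside out. A row product depends on its row only and is decreasing;
    its complement is increasing with no Hessian across rows. Multiplying the complements creates
    cross terms [D1 m * D2 m' >= 0], and the last complement reverses their sign. *)
Lemma smooth3_minmax la r : 0 <= la ->
  smooth3 (fun D H => forall m m' : W * V, m.1 != m'.1 -> H m m' <= 0) (smooth_minmax la r).
Proof.
move=> la0.
apply: (@smooth3_onem _ _ (fun D H => (forall m : W * V, 0 <= D m) /\
    forall m m', m.1 != m'.1 -> 0 <= H m m')).
  by move=> D H [_ H0] m m' mm'; rewrite oppr_le0 H0.
apply: smooth3_prod => //.
  move=> a b D1 H1 D2 H2 a0 b0 [D10 H10] [D20 H20]; split=> [m|m m' mm'].
    by rewrite addr_ge0// mulr_ge0.
  by rewrite !addr_ge0// mulr_ge0// ?H10 ?H20.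
move=> w.
(* Invariant of a partial product along row [w]: decreasing, with gradient and Hessian supported on
   that row. *)
pose S (D : W * V -> R) (H : W * V -> W * V -> R) :=
  [/\ forall m, D m <= 0, forall m, m.1 != w -> D m = 0 &
      forall m m', (m.1 != w) || (m'.1 != w) -> H m m' = 0].
apply: (@smooth3_onem _ _ S).
  move=> D H [D0 _ H0]; split=> [m|m m' mm']; first by rewrite oppr_ge0.
  rewrite H0 ?oppr0//; have [e|//] := eqVneq m.1 w.
  by move: mm'; rewrite e eq_sym.
apply: smooth3_prod.
- by split.
- move=> a b D1 H1 D2 H2 a0 b0 [D10 D11 H10] [D20 D21 H20]; split=> [m|m mw|m m' mm'].
  + by rewrite -oppr_ge0 opprD addr_ge0// -mulrN mulr_ge0// oppr_ge0.
  + by rewrite D11// D21// !mulr0 addr0.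
  + rewrite H10// H20// !mulr0 !add0r.
    by case/orP: mm' => h; [rewrite D11// mul0r|rewrite D21// mulr0].
- move=> v; apply: smooth3_weaken (smooth3_logistic (r (w, v)) (w, v) la0).
  move=> D H [D0 D1 H1]; split=> // [m mw|m m' mm'].
    by apply: D1; apply: contra mw => /eqP ->.
  apply: H1; case/orP: mm' => h; apply/orP; [left|right];
    by apply: contra h => /eqP ->.
Qed.

Lemma measurable_smooth_minmax la r d (T : measurableType d) (Z : W * V -> T -> R) :
  (forall m, measurable_fun setT (Z m)) ->
  measurable_fun setT (fun w => smooth_minmax la r (Z^~ w)).
Proof.
move=> mZ; apply: measurable_funB; first exact: measurable_cst.
apply: measurable_prod => w _; apply: measurable_funB; first exact: measurable_cst.
apply: measurable_prod => v _; apply: measurableT_comp; first exact: measurable_logistic.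
apply: measurable_funM; first exact: measurable_cst.
by apply: measurable_funB; [exact: mZ|exact: measurable_cst].
Qed.

Lemma prod_unit_itv (J : Type) (s : seq J) (x : J -> R) :
  (forall j, 0 <= x j <= 1) -> 0 <= \prod_(j <- s) x j <= 1.
Proof.
move=> x01; elim: s => [|j s /andP[h0 h1]]; first by rewrite big_nil ler01 lexx.
by rewrite big_cons; have /andP[? ?] := x01 j; rewrite mulr_ge0//= mulr_ile1.
Qed.

(** Weierstrass product inequality, the multiplicative form of a union bound. *)
Lemma prod_ge_onem (J : Type) (s : seq J) (x : J -> R) (eta : R) :
  (forall j, 0 <= x j <= 1) -> (forall j, 1 - eta <= x j) ->
  1 - (size s)%:R * eta <= \prod_(j <- s) x j.
Proof.
move=> x01 xeta; elim: s => [|j s IH]; first by rewrite big_nil mul0r subr0.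
rewrite big_cons /= -natr1 mulrDl mul1r.
have /andP[h0 h1] := prod_unit_itv s x01.
have /andP[x0 x1] := x01 j; have := xeta j.
move: IH; move: (\prod_(_ <- _) _) h0 h1 => p p0 p1; move: (_%:R * eta) => N.
nra.
Qed.

Lemma smooth_minmax_ge la r (z : W * V -> R) (eta : R) :
  (exists w, forall v, 1 - eta <= logistic (la * (z (w, v) - r (w, v)))) ->
  1 - #|V|%:R * eta <= smooth_minmax la r z.
Proof.
move=> [w hw]; rewrite /smooth_minmax (bigD1 w)//=.
have log01 w' v : 0 <= logistic (la * (z (w', v) - r (w', v))) <= 1.
  by rewrite logistic_ge0 logistic_le1.
have := prod_ge_onem (index_enum V) (log01 w) hw.
rewrite (_ : size _ = #|V|); last by rewrite cardT enumT.
have /andP[] := prod_unit_itv (index_enum V) (log01 w).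
have : 0 <= \prod_(i | i != w) (1 - \prod_v logistic (la * (z (i, v) - r (i, v)))) <= 1.
  rewrite -big_filter; apply: prod_unit_itv => w'.
  have /andP[? ?] := prod_unit_itv (index_enum V) (log01 w').
  by rewrite subr_ge0 lerBlDr lerDl; apply/andP.
move=> /andP[]; move: (\prod_(_ | _) _) (\prod_v _) => p q p0 p1 q0 q1.
move: (_ * eta) => N; nra.
Qed.

Lemma smooth_minmax_le la r (z : W * V -> R) (eta : R) :
  (forall w, exists v, logistic (la * (z (w, v) - r (w, v))) <= eta) ->
  smooth_minmax la r z <= #|W|%:R * eta.
Proof.
move=> hw.
have log01 w' v : 0 <= logistic (la * (z (w', v) - r (w', v))) <= 1.
  by rewrite logistic_ge0 logistic_le1.
have row01 w : 0 <= \prod_v logistic (la * (z (w, v) - r (w, v))) <= 1.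
  exact: prod_unit_itv.
have h w : 1 - eta <= 1 - \prod_v logistic (la * (z (w, v) - r (w, v))).
  have [v hv] := hw w; rewrite lerD2l lerN2 (bigD1 v)//= (le_trans _ hv)//.
  rewrite ler_piMr ?logistic_ge0// -big_filter.
  by have /andP[] := prod_unit_itv [seq i <- index_enum V | i != v] (log01 w).
have := @prod_ge_onem _ (index_enum W) _ eta _ h.
rewrite (_ : size _ = #|W|); last by rewrite cardT enumT.
rewrite /smooth_minmax => /(_ _) h'; rewrite lerBlDr -lerBlDl; apply: h' => w.
by have /andP[? ?] := row01 w; rewrite subr_ge0 lerBlDr lerDl; apply/andP.
Qed.

Lemma measurable_minmax_event d (T : measurableType d) (Z : W * V -> T -> R) (s : R) :
  (forall m, measurable_fun setT (Z m)) ->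
  measurable [set om | exists w, forall v, Z (w, v) om < s].
Proof.
move=> mZ; rewrite (_ : mkset _ =
  \bigcup_(w in [set: W]) \bigcap_(v in [set: V]) [set om | Z (w, v) om < s]).
  apply: fin_bigcup_measurable => // w _; apply: fin_bigcap_measurable => // v _.
  rewrite (_ : mkset _ = setT `&` Z (w, v) @^-1` `]-oo, s[%classic).
    by apply: mZ => //; exact: measurable_itv.
  by rewrite setTI; apply/seteqP; split=> om /=; rewrite in_itv.
apply/seteqP; split=> om /=.
  by move=> [w h]; exists w => // v _; exact: h.
by move=> [w _ h]; exists w => v; exact: (h v Logic.I).
Qed.

End minmax_smoothing.

(** * Gordon's comparison for finite Gaussian arrays *)

Section gordon.
Context {R : realType} d (T : measurableType d) (P : probability T R) (I W V : finType).
Variables (X : I -> T -> R) (cX cY : W * V -> I -> R) (b : W * V -> R).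
Hypothesis iX : iid_std_normal P X.
Hypothesis cov_row : forall m m', m.1 = m'.1 -> cov cX m m' = cov cY m m'.
Hypothesis cov_le : forall m m', cov cX m m' <= cov cY m m'.

Let ev (c : W * V -> I -> R) (s : R) :=
  [set om | exists w, forall v, lin c (X^~ om) (w, v) + b (w, v) < s].

Let mlin c m : measurable_fun setT (fun om => lin c (X^~ om) m + b m).
Proof.
by apply: measurable_funD; [exact: (measurable_lin iX)|exact: measurable_cst].
Qed.

Lemma gordon_comparison (s t : R) : s < t -> (P (ev cY s) <= P (ev cX t))%E.
Proof.
move=> st; pose de := (t - s) / 2; have de0 : 0 < de by rewrite divr_gt0// subr_gt0.
have mev c u : measurable (ev c u).
  exact: (measurable_minmax_event (Z := fun m om => lin c (X^~ om) m + b m) _ (mlin c)).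
pose N : R := #|V|%:R + #|W|%:R.
have N0 : 0 <= N by rewrite addr_ge0.
apply/lee_addgt0Pr => e e0.
(* Chosen so that [la * de = N / e]; then [N * eta <= e] because [exp (N / e) >= N / e]. *)
pose la := N / (de * e).
have la0 : 0 <= la by rewrite divr_ge0// ltW// mulr_gt0.
pose eta : R := expR (- (la * de)).
have eta0 : 0 <= eta by exact: expR_ge0.
have etaN : N * eta <= e.
  rewrite /eta expRN -/(_ / _) ler_pdivrMr ?expR_gt0//.
  have := expR_ge1Dx (la * de).
  have -> : la * de = N / e by rewrite /la; field; rewrite !gt_eqF.
  move=> h; have : e * (N / e) <= e * expR (N / e) by rewrite ler_wpM2l ?(ltW e0)//; lra.
  by rewrite mulrCA divff ?gt_eqF// mulr1.
(* The logistic switches at the midpoint of [s] and [t], at distance [de] from both; the shift [b]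
   is absorbed into the threshold. *)
pose r (m : W * V) := (s + t) / 2 - b m.
have sr : (s + t) / 2 - s = de by rewrite /de; field.
have tr : t - (s + t) / 2 = de by rewrite /de; field.
pose F := smooth_minmax la r.
have [F01 [C C0 Fexp]] := @smooth3_minmax R W V la r la0.
have mF d' (T' : measurableType d') (Z : W * V -> T' -> R) :
    (forall m, measurable_fun setT (Z m)) -> measurable_fun setT (fun w => F (Z^~ w)).
  exact: measurable_smooth_minmax.
have [K K0 step] : exists2 K, 0 <= K & forall eps z, 0 <= eps ->
    (\int[P]_w (F (fun m => z m + eps * lin cY (X^~ w) m)%R)%:E <=
     \int[P]_w (F (fun m => z m + eps * lin cX (X^~ w) m)%R)%:E + (K * eps ^+ 3)%:E)%E.
  apply: (lindeberg_step iX C0 mF F01) => z.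
  have [D [H [SH _ _ E]]] := Fexp z; exists D, H => // m m'.
  have [mm'|mm'] := eqVneq m.1 m'.1; first by rewrite cov_row// subrr mulr0.
  by rewrite mulr_le0_ge0 ?SH// subr_ge0.
have F0 y : 0 <= F y by have /andP[] := F01 y.
have EF := gaussian_path_le iX mF F0 K0 step.
have mFl c : measurable_fun setT (fun om => F (lin c (X^~ om))).
  by apply: (mF _ _ (fun m om => lin c (X^~ om) m)) => m; exact: (measurable_lin iX).
have indE A : measurable A -> (\int[P]_om (\1_A om)%:E = P A)%E.
  by move=> mA; rewrite integral_indic// setIT.
have int_cst (f : T -> R) k : measurable_fun setT f -> (forall x, 0 <= f x) -> 0 <= k ->
    (\int[P]_x (f x + k)%:E = \int[P]_x (f x)%:E + k%:E)%E.
  move=> mf f0 k0; under eq_integral do rewrite EFinD.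
  rewrite ge0_integralD//=; last 2 first.
  - by move=> x _; rewrite lee_fin.
  - exact/measurable_EFinP.
  rewrite integral_cst//.
  by rewrite [X in (_ + _ * X)%E](@probability_setT _ _ _ P) mule1.
(* On the event some row has all entries below [s], so each logistic factor of that row is at least
   [1 - eta]. *)
have lower : (P (ev cY s) <= \int[P]_om (F (lin cY (X^~ om)))%:E + (#|V|%:R * eta)%:E)%E.
  rewrite -indE// -int_cst ?mulr_ge0//.
  apply: ge0_le_integral => //.
  - exact/measurable_EFinP/measurable_indic.
  - by apply/measurable_EFinP; apply: measurable_funD => //; exact: mFl.
  move=> om _; rewrite lee_fin indicE; have [/set_mem [w h]|_] := boolP (om \in _).
    rewrite -lerBlDr; apply: smooth_minmax_ge; exists w => v.
    apply: le_trans (logistic_ge_expR _); rewrite lerD2l lerN2 ler_expR -mulrN ler_wpM2l//.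
    by have := h v; rewrite /r; lra.
  by rewrite addr_ge0// mulr_ge0.
(* Off the event every row has an entry at least [t], whose logistic factor is at most [eta]. *)
have upper : (\int[P]_om (F (lin cX (X^~ om)))%:E <= P (ev cX t) + (#|W|%:R * eta)%:E)%E.
  have mI : measurable_fun setT (\1_(ev cX t) : T -> R) by exact: measurable_indic.
  have I0 x : 0 <= \1_(ev cX t) x :> R by rewrite indicE.
  rewrite -indE// -(int_cst _ _ mI I0) ?mulr_ge0//.
  apply: ge0_le_integral => //.
  - by move=> om _; rewrite lee_fin.
  - by apply/measurable_EFinP; exact: mFl.
  - by apply/measurable_EFinP; apply: measurable_funD => //; exact: measurable_indic.
  move=> om _; rewrite lee_fin indicE; have [_|/negP h] := boolP (om \in _).
    by have /andP[_ /le_trans] := F01 (lin cX (X^~ om)); apply; rewrite lerDl mulr_ge0.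
  rewrite add0r; apply: smooth_minmax_le => w; apply: contrapT => /forallNP hv; apply: h.
  apply/mem_set; exists w => v; rewrite ltNge; apply/negP => tle; apply: (hv v).
  apply: le_trans (logistic_le_expRN _) _; rewrite ler_expR lerN2 ler_wpM2l//.
  by rewrite /r; lra.
apply: (le_trans lower); apply: (@le_trans _ _ (P (ev cX t) + (N * eta)%:E)%E); last first.
  by rewrite leeD2l// lee_fin.
rewrite (_ : N * eta = #|W|%:R * eta + #|V|%:R * eta); last by rewrite /N; ring.
by rewrite EFinD addeA; apply: leeD2r; exact: le_trans EF upper.
Qed.

End gordon.

(** * Comparison on finite index sets *)

Section euclidean.
Context {R : realType}.

Lemma dotvE m (x y : 'rV[R]_m) : dotv x y = \sum_i x ord0 i * y ord0 i.
Proof. by rewrite /dotv mxE; apply: eq_bigr => i _; rewrite mxE. Qed.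

Lemma bilinE n d (b : 'rV[R]_n) (A : 'M[R]_(n, d)) (a : 'rV[R]_d) :
  bilin b A a = \sum_i \sum_j b ord0 i * a ord0 j * A i j.
Proof.
rewrite /bilin mxE exchange_big; apply: eq_bigr => j _ /=.
by rewrite !mxE mulr_suml; apply: eq_bigr => i _; rewrite mulrAC.
Qed.

Lemma enorm_ge0 m (x : 'rV[R]_m) : 0 <= enorm x.
Proof. exact: sqrtr_ge0. Qed.

Lemma enorm_sqr m (x : 'rV[R]_m) : enorm x * enorm x = dotv x x.
Proof.
rewrite -expr2 sqr_sqrtr; last by apply: sumr_ge0 => i _; rewrite sqr_ge0.
by rewrite dotvE; apply: eq_bigr => i _; rewrite expr2.
Qed.

(** Cauchy-Schwarz from the square of [|y| x - |x| y], which is informative when both norms are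
    positive; otherwise one vector is zero. *)
Lemma dotv_le_enorm m (x y : 'rV[R]_m) : dotv x y <= enorm x * enorm y.
Proof.
have [AB|AB] := ltP 0 (enorm x * enorm y).
  have : 0 <= \sum_i (enorm y * x ord0 i - enorm x * y ord0 i) ^+ 2.
    by apply: sumr_ge0 => i _; rewrite sqr_ge0.
  have -> : \sum_i (enorm y * x ord0 i - enorm x * y ord0 i) ^+ 2 =
      enorm y ^+ 2 * dotv x x + enorm x ^+ 2 * dotv y y - 2 * (enorm x * enorm y) * dotv x y.
    rewrite !dotvE !mulr_sumr -big_split -sumrB; apply: eq_bigr => i _ /=; ring.
  rewrite -!enorm_sqr; move: (dotv x y) => D h.
  have : 0 <= 2 * (enorm x * enorm y) * (enorm x * enorm y - D).
    by move: h; rewrite [X in 0 <= X -> _](_ : _ =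
      2 * (enorm x * enorm y) * (enorm x * enorm y - D)) //; ring.
  by rewrite pmulr_rge0 ?subr_ge0// mulr_gt0.
have AB0 : enorm x * enorm y = 0.
  by apply/eqP; rewrite eq_le AB mulr_ge0// enorm_ge0.
have zero (z : 'rV[R]_m) i : enorm z = 0 -> z ord0 i = 0.
  move=> z0; have := enorm_sqr z; rewrite z0 mul0r dotvE => /esym/eqP.
  rewrite psumr_eq0 => [/allP /(_ i (mem_index_enum i)) /=|j _].
    by rewrite mulf_eq0 orbb => /eqP.
  by rewrite -expr2 sqr_ge0.
rewrite AB0 dotvE big1// => i _.
by move/eqP: AB0; rewrite mulf_eq0 => /orP[] /eqP /(zero _ i) ->; rewrite ?mulr0 ?mul0r.
Qed.

End euclidean.

Section gidx_sum.
Context {R : realType} {k d : nat} {n : 'I_k -> nat}.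

Definition idxG l i j : gidx d n :=
  inl (inl (existT (fun l : 'I_k => ('I_(n l) * 'I_d)%type) l (i, j))).
Definition idxg l j : gidx d n := inl (inr (existT (fun=> 'I_d) l j)).
Definition idxh l i : gidx d n := inr (existT (fun l : 'I_k => 'I_(n l)) l i).

(** Grouping the indices by [l] allows covariances and linear forms to be compared one [l] at a
    time. *)
Lemma sum_gidx (f : gidx d n + 'I_k -> R) :
  \sum_e f e = \sum_l (\sum_(i < n l) \sum_j f (inl (idxG i j))
                       + \sum_j f (inl (idxg l j))
                       + \sum_(i < n l) f (inl (idxh i))
                       + f (inr l)).
Proof.
rewrite big_sumType /= big_sumType /= big_sumType /= !big_split /=.
congr (_ + _ + _ + _).
- under [RHS]eq_bigr => l _ do rewrite pair_bigA /=.
  rewrite sig_big_dep /=; apply: eq_bigr => -[l [i j]] _ //.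
- by rewrite sig_big_dep /=; apply: eq_bigr => -[l j] _.
- by rewrite sig_big_dep /=; apply: eq_bigr => -[l j] _.
Qed.

End gidx_sum.

Section finite_comparison.
Context {R : realType} {k d : nat} {n : 'I_k -> nat}.
Context {dT : measure_display} {T : measurableType dT} (P : probability T R).
Variables (G : forall l : 'I_k, T -> 'M[R]_(n l, d)) (g : 'I_k -> T -> 'rV[R]_d)
  (h : forall l : 'I_k, T -> 'rV[R]_(n l)).
Hypothesis hG : iid_std_normal P (gentries G g h).
Variables (W V : finType) (a : W -> 'I_k -> 'rV[R]_d)
  (b : V -> forall l : 'I_k, 'rV[R]_(n l)) (psi : W * V -> R).

(** Coefficients over one common index set, all Gaussian entries plus [k] extra normals, so that
    both processes are linear forms in the same i.i.d. family. *)
Let cY (m : W * V) (e : gidx d n + 'I_k) : R :=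
  match e with
  | inl (inl (inl (existT l ij))) => b m.2 l ord0 ij.1 * a m.1 l ord0 ij.2
  | inl _ => 0
  | inr l => enorm (a m.1 l) * enorm (b m.2 l)
  end.

Let cX (m : W * V) (e : gidx d n + 'I_k) : R :=
  match e with
  | inl (inl (inr (existT l j))) => enorm (b m.2 l) * a m.1 l ord0 j
  | inl (inr (existT l i)) => enorm (a m.1 l) * b m.2 l ord0 i
  | _ => 0
  end.

Let cov_sub m m' : cov cY m m' - cov cX m m' =
  \sum_l (enorm (a m.1 l) * enorm (a m'.1 l) - dotv (a m.1 l) (a m'.1 l)) *
         (enorm (b m.2 l) * enorm (b m'.2 l) - dotv (b m.2 l) (b m'.2 l)).
Proof.
rewrite /cov !sum_gidx -sumrB; apply: eq_bigr => l _ /=.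
rewrite !dotvE.
under [X in (X + _ + _ + _) - _]eq_bigr => i _ do under eq_bigr => j _ do
  rewrite (mulrACA (b _ _ _ _)).
rewrite -big_distrlr /=.
rewrite [X in _ + X + _ + _ - _]big1 => [|j _]; last by rewrite mul0r.
rewrite [X in _ + _ + X + _ - _]big1 => [|j _]; last by rewrite mul0r.
rewrite [X in _ - (X + _ + _ + _)]big1 => [|i _]; last by rewrite big1// => j _; rewrite mul0r.
under [X in _ - (_ + X + _ + _)]eq_bigr => j _ do rewrite mulrACA.
under [X in _ - (_ + _ + X + _)]eq_bigr => j _ do rewrite mulrACA.
rewrite -!mulr_sumr; ring.
Qed.

Let evPhi (s : R) := [set om | exists w, forall v,
  \sum_(l < k) bilin (b v l) (G l om) (a w l) + psi (w, v) < s].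

Let evphi (s : R) := [set om | exists w, forall v,
  \sum_(l < k) (enorm (b v l) * dotv (g l om) (a w l)
                + enorm (a w l) * dotv (h l om) (b v l)) + psi (w, v) < s].

Let mentry e : measurable_fun setT (gentries G g h e). Proof. by case: hG. Qed.

Let mG l i j : measurable_fun setT (fun om => G l om i j).
Proof. exact: (mentry (idxG i j)). Qed.

Let mg l j : measurable_fun setT (fun om => g l om ord0 j).
Proof. exact: (mentry (idxg l j)). Qed.

Let mh l i : measurable_fun setT (fun om => h l om ord0 i).
Proof. exact: (mentry (idxh i)). Qed.

Lemma measurable_bilin_sum (x : forall l, 'rV[R]_(n l)) (y : 'I_k -> 'rV[R]_d) :
  measurable_fun setT (fun om => \sum_(l < k) bilin (x l) (G l om) (y l)).
Proof.
apply: measurable_sum => l; under eq_fun do rewrite bilinE.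
apply: measurable_sum => i; apply: measurable_sum => j.
by apply: measurable_funM; [exact: measurable_cst|exact: mG].
Qed.

Lemma measurable_dotv_sum (x : forall l, 'rV[R]_(n l)) (y : 'I_k -> 'rV[R]_d) :
  measurable_fun setT (fun om => \sum_(l < k) (enorm (x l) * dotv (g l om) (y l)
    + enorm (y l) * dotv (h l om) (x l))).
Proof.
apply: measurable_sum => l; under eq_fun do rewrite !dotvE.
by apply: measurable_funD; apply: measurable_funM; do ?exact: measurable_cst;
  apply: measurable_sum => i; apply: measurable_funM; do ?exact: measurable_cst;
  do ?exact: mg; exact: mh.
Qed.

Let measurable_evPhi s : measurable (evPhi s).
Proof.
apply: (measurable_minmax_event
  (Z := fun m om => \sum_(l < k) bilin (b m.2 l) (G l om) (a m.1 l) + psi m)) => m.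
by apply: measurable_funD; [exact: measurable_bilin_sum|exact: measurable_cst].
Qed.

Let measurable_evphi s : measurable (evphi s).
Proof.
apply: (measurable_minmax_event (Z := fun m om =>
  \sum_(l < k) (enorm (b m.2 l) * dotv (g l om) (a m.1 l)
                + enorm (a m.1 l) * dotv (h l om) (b m.2 l)) + psi m)) => m.
by apply: measurable_funD; [exact: measurable_dotv_sum|exact: measurable_cst].
Qed.

(* On the event that the [k] extra standard normals [gam l] are nonpositive, which is
   independent of [G] and has probability at least [2^-k], adding
   [gam l * enorm (a w l) * enorm (b v l)] can only decrease the bilinear process;
   the sum has the same variances as the decoupled process. *)
Lemma finite_comparison (s t : R) : s < t ->
  (P (evPhi s) <= ((2 : R) ^+ k)%:E * P (evphi t))%E.
Proof.
move=> st.
have [d' [T' [P' [gam igam]]]] := @exists_iid_std_normal R 'I_k.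
have ixi := iid_pair hG igam; set xi := (fun e w => _) in ixi.
have linY om m : lin cY (xi^~ om) m =
    \sum_(l < k) bilin (b m.2 l) (G l om.1) (a m.1 l)
    + \sum_(l < k) enorm (a m.1 l) * enorm (b m.2 l) * gam l om.2.
  rewrite /lin sum_gidx -big_split; apply: eq_bigr => l _ /=.
  rewrite bilinE [X in _ + X + _ + _ = _]big1 => [|j _]; last by rewrite mul0r.
  rewrite [X in _ + _ + X + _ = _]big1 => [|j _]; last by rewrite mul0r.
  by rewrite !addr0.
have linX om m : lin cX (xi^~ om) m =
    \sum_(l < k) (enorm (b m.2 l) * dotv (g l om.1) (a m.1 l)
                  + enorm (a m.1 l) * dotv (h l om.1) (b m.2 l)).
  rewrite /lin sum_gidx; apply: eq_bigr => l _ /=.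
  rewrite !dotvE [X in X + _ + _ + _ = _]big1 ?add0r => [|i _]; last first.
    by rewrite big1// => j _; rewrite mul0r.
  rewrite mul0r addr0 !mulr_sumr.
  by congr (_ + _); apply: eq_bigr => i _; rewrite -mulrA [X in _ * X]mulrC.
have cmp : (prod_prob P P' [set om | exists w, forall v,
      (lin cY (xi^~ om) (w, v) + psi (w, v) < s)%R] <=
    prod_prob P P' [set om | exists w, forall v,
      (lin cX (xi^~ om) (w, v) + psi (w, v) < t)%R])%E.
  apply: gordon_comparison => // m m'.
    move=> mm'; apply/esym/eqP; rewrite -subr_eq0 cov_sub big1// => l _.
    by rewrite mm' enorm_sqr subrr mul0r.
  rewrite -subr_ge0 cov_sub sumr_ge0// => l _.
  by rewrite mulr_ge0// subr_ge0 dotv_le_enorm.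
pose Gam := \bigcap_(l in [set: 'I_k]) (gam l @^-1` `]-oo, 0]%classic).
have mGam : measurable Gam.
  apply: fin_bigcap_measurable => // l _; rewrite -[X in measurable X]setTI.
  by case: igam => mgam _; apply: mgam => //; exact: measurable_itv.
have PGam : (((2 : R) ^- k)%:E <= P' Gam)%E.
  have [_ ->] := igam; last by move=> l; exact: measurable_itv.
  have -> : ((2 : R) ^- k)%:E = (\prod_(l < k) (2^-1 : R)%:E)%E.
    by rewrite prodEFin prodr_const card_ord exprVn.
  (* Nonnegativity is carried along because products of extended reals are monotone only for
     nonnegative factors. *)
  suff : (0 <= \prod_(l < k) (2^-1 : R)%:E <=
      \prod_(l < k) normal_prob (0 : R) 1 `]-oo, 0%R]%classic)%E.
    by case/andP.
  elim/big_ind2 : _ => [|x1 x2 y1 y2 /andP[x0 x12] /andP[y0 y12]|l _].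
  - by rewrite lexx lee_fin ler01.
  - by rewrite mule_ge0//= lee_pmul.
  - by rewrite lee_fin invr_ge0 ler0n normal_prob_le0.
have step1 : (P (evPhi s) * P' Gam <= P (evphi t))%E.
  rewrite -prod_probE//; apply: (le_trans (le_trans _ cmp)).
    apply: le_measure; rewrite ?inE.
    - exact: measurableX.
    - apply: (measurable_minmax_event (Z := fun m om => lin cY (xi^~ om) m + psi m)) => m.
      by apply: measurable_funD; [exact: (measurable_lin ixi)|exact: measurable_cst].
    move=> [x y] /= [[w hw] hy]; exists w => v; rewrite linY /=.
    apply: le_lt_trans (hw v); rewrite lerD2r gerDl sumr_le0// => l _.
    by rewrite mulr_ge0_le0 ?mulr_ge0 ?enorm_ge0//; have := hy l Logic.I; rewrite /= in_itv.
  (* The decoupled process does not involve [gam], so its event is a cylinder. *)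
  rewrite (_ : mkset _ = evphi t `*` setT).
    by rewrite prod_probE// [X in (_ * X)%E](@probability_setT _ _ _ P') mule1.
  by apply/seteqP; split=> -[x y] /= => [[w hw]|[[w hw] _]]; [split => //|];
    exists w => v; have := hw v; rewrite linX.
have : (P (evPhi s) * ((2 : R) ^- k)%:E <= P (evphi t))%E.
  by apply: le_trans step1; exact: lee_wpmul2l.
rewrite -(@fineK _ (P (evPhi s))) ?fin_num_measure//.
rewrite -(@fineK _ (P (evphi t))) ?fin_num_measure//.
by rewrite -!EFinM !lee_fin ler_pdivrMr ?exprn_gt0// mulrC.
Qed.

End finite_comparison.

(** * Compact index sets *)

Section dense_sequences.
Context {R : realType}.

Definition dense_seq_in {X : topologicalType} (S : set X) (w : nat -> X) :=
  (forall i, S (w i)) /\ forall x U, S x -> nbhs x U -> exists i, U (w i).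

(** [S] may contain no rational point, so each rational vector and scale selects a point of [S]
    within that scale if there is one, and the default [x0], also in [S], otherwise. *)
Lemma exists_dense_seq_rV (n : nat) (S : set 'rV[R]_n) : S !=set0 ->
  exists w, dense_seq_in S w.
Proof.
move=> [x0 Sx0].
pose near_rat (c : 'rV[rat]_n * nat) :=
  [set x | S x /\ forall j, `|x ord0 j - ratr (c.1 ord0 j)| < c.2.+1%:R^-1].
pose w i := if unpickle i is Some c then xget x0 (near_rat c) else x0.
exists w; split=> [i|x U Sx].
  rewrite /w; case: unpickle => // c.
  by case: xgetP => // x _ [].
move=> /nbhs_ballP[e /= e0 eU].
(* Both [x] and the selected point lie within [1 / (p + 1)] of the same rational vector, hence half
   of [e]. *)
have [p pe] : exists p : nat, p.+1%:R^-1 < e / 2.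
  exists (Num.truncn (2 / e)).
  rewrite -[ltRHS]invrK ltf_pV2 ?posrE ?ltr0n ?invr_gt0 ?divr_gt0//.
  by rewrite invf_div truncnS_gt.
have rat_near j : {q : rat | `|x ord0 j - ratr q| < p.+1%:R^-1}.
  apply: cid; have [q] : exists q : rat, ratr q \in `]x ord0 j - p.+1%:R^-1, x ord0 j + p.+1%:R^-1[.
    apply: rat_in_itvoo; rewrite ltrD2l; apply: (@lt_trans _ _ 0).
      by rewrite oppr_lt0 invr_gt0 ltr0n.
    by rewrite invr_gt0 ltr0n.
  by rewrite in_itv/= => q12; exists q; rewrite ltr_distlC.
pose r : 'rV[rat]_n := \row_j sval (rat_near j).
have xr : near_rat (r, p) x.
  by split=> // j; rewrite mxE; case: (rat_near j).
exists (pickle (r, p)); apply: eU; rewrite /w pickleK.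
have [_ wr] := xgetPex x0 (ex_intro _ x xr).
split=> // i j; rewrite (ord1 i) /ball /=.
have [_ /(_ j) xrj] := xr.
apply: le_lt_trans (ler_distD (ratr ((r, p).1 ord0 j)) _ _) _.
by rewrite [X in _ + X]distrC [ltRHS]splitr ltrD// (lt_trans _ pe).
Qed.

(** The boxes around [v] generate a filter, and convergence in the product topology is checked one
    coordinate at a time. *)
Lemma prod_topology_box {I : finType} (K : I -> topologicalType)
    (v : prod_topology K) (U : set (prod_topology K)) : nbhs v U ->
  exists2 A : forall i, set (K i), (forall i, nbhs (v i) (A i)) &
    forall f : prod_topology K, (forall i, A i (f i)) -> U f.
Proof.
pose box (A : forall i, set (K i)) : set (prod_topology K) := [set f | forall i, A i (f i)].
pose F : set_system (prod_topology K) :=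
  filter_from [set A : forall i, set (K i) | forall i, nbhs (v i) (A i)] box.
have FF : Filter F.
  apply: filter_from_filter; first by exists (fun=> setT) => i; exact: filterT.
  move=> A B nA nB; exists (fun i => A i `&` B i); first by move=> i; exact: filterI.
  by move=> f h; split=> i; have [] := h i.
suff Fv : F --> v by move=> /Fv [A nA AU]; exists A => // f Af; exact: AU.
apply/cvg_sup => i B; rewrite nbhsE => -[D [[C oC <-] Cv] DB].
exists (dfwith (fun=> setT) i C : forall i, set (K i)).
  move=> j; have [<-|ij] := eqVneq i j.
    by rewrite dfwithin; exact: open_nbhs_nbhs.
  by rewrite dfwithout//; exact: filterT.
by move=> f /(_ i); rewrite dfwithin => Cf; exact: DB.
Qed.

Lemma exists_dense_seq_prod (k : nat) (n : 'I_k -> nat) (S : forall l, set 'rV[R]_(n l)) :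
  (forall l, S l !=set0) ->
  exists v : nat -> prod_topology (fun l => 'rV[R]_(n l)),
    dense_seq_in [set v : prod_topology (fun l => 'rV[R]_(n l)) | forall l, S l (v l)] v.
Proof.
move=> S0.
have dS l : {w | dense_seq_in (S l) w} by apply: cid; exact: exists_dense_seq_rV.
pose pt (c : {ffun 'I_k -> nat}) : prod_topology (fun l => 'rV[R]_(n l)) :=
  fun l => sval (dS l) (c l).
exists (fun i => pt (odflt [ffun=> 0%N] (unpickle i))); split=> [i l|x U Sx].
  by rewrite /pt; have [Sw _] := svalP (dS l); exact: Sw.
move=> nU; have [A nA AU] := prod_topology_box nU.
have c l : {i | A l (sval (dS l) i)}.
  by apply: cid; have [_ dw] := svalP (dS l); exact: (dw (x l) _ (Sx l) (nA l)).
exists (pickle [ffun l => sval (c l)]); rewrite pickleK; apply: AU => l.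
by rewrite /pt ffunE; case: (c l).
Qed.

End dense_sequences.

(** * Min-max events through countable dense sets *)

Section minmax_dense.
Context {R : realType} {X Y : topologicalType} (Sw : set X) (Sv : set Y).
Variables (F : X -> Y -> R) (w : nat -> X) (v : nat -> Y).
Hypothesis cSw : compact Sw.
Hypothesis cSv : compact Sv.
Hypothesis dw : dense_seq_in Sw w.
Hypothesis dv : dense_seq_in Sv v.
Hypothesis cF : {within Sw `*` Sv, continuous (fun xy => F xy.1 xy.2)}.

Let cvgF x y : Sw x -> Sv y -> forall A, nbhs (F x y) A ->
  exists U V, [/\ nbhs x U, nbhs y V &
    forall x' y', U x' -> V y' -> Sw x' -> Sv y' -> A (F x' y')].
Proof.
move=> Sx Sy A nA; have /subspace_continuousP /(_ (x, y) (conj Sx Sy)) /(_ A nA) := cF.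
rewrite /= /within /= => -[[U V] /= [nU nV] UV].
by exists U, V; split=> // x' y' Ux Vy Sx' Sy'; exact: (UV (x', y')).
Qed.

Let bounded : exists M, forall x y, Sw x -> Sv y -> `|F x y| <= M.
Proof.
have cpt := continuous_compact cF (compact_setX cSw cSv).
have [M [_ hM]] := compact_bounded cpt.
exists (M + 1) => x y Sx Sy; apply: (hM (M + 1)); first by rewrite ltrDl.
by exists (x, y).
Qed.

(** Turns an uncountable inf of sups into a countable condition. Forwards, compactness of [Sv]
    spreads a strict bound at one [x] to a neighbourhood, which contains some [w i]. Backwards, the
    non-strict bound with a margin passes from the [v j] to all of [Sv] by continuity, and the
    margin keeps the final inequality strict. *)
Lemma minmax_ltP (t : R) : minmax Sw Sv F < t <->
  exists p i : nat, forall j, F (w i) (v j) <= t - p.+1%:R^-1.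
Proof.
have [M FM] := bounded.
have [Sw_w dw'] := dw; have [Sv_v dv'] := dv.
have ubF x : Sw x -> has_ubound [set F x y | y in Sv].
  by move=> Sx; exists M => _ [y Sy <-]; exact: le_trans (ler_norm _) (FM _ _ Sx Sy).
split.
  move=> /inf_lt []; first by exists (sup [set F (w 0%N) y | y in Sv]); exists (w 0%N).
  move=> _ [x Sx <-] supt.
  set s := (sup [set F x y | y in Sv] + t) / 2.
  have [p ps] : exists p : nat, s <= t - p.+1%:R^-1.
    have ts : 0 < t - s by rewrite /s; lra.
    exists (Num.truncn (t - s)^-1); rewrite lerBrDl -lerBrDr.
    rewrite -[leRHS]invrK lef_pV2 ?posrE ?ltr0n ?invr_gt0//.
    by rewrite ltW// truncnS_gt.
  have Fs y : Sv y -> F x y < s.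
    move=> Sy; have : F x y <= sup [set F x y | y in Sv].
      by apply: ub_le_sup; [exact: ubF|exists y].
    by rewrite /s; lra.
  (* Tube lemma: one neighbourhood of [x] serves all [y] in [Sv]. *)
  have : \forall x' \near within Sw (nbhs x), Sv `<=` (fun y => F x' y < s).
    have /compact_near_coveringP/near_covering_withinP := cSv; apply.
    move=> y Sy; have ns := open_nbhs_nbhs (conj (@open_lt R s) (Fs y Sy)).
    have [U [V [nU nV UV]]] := cvgF Sx Sy ns.
    exists (V, U `&` Sw) => /=.
      by split=> //; rewrite /within /=; apply: filterS nU.
    by move=> [y' x'] /= [Vy [Ux Sx']] Sy'; exact: UV.
  rewrite /within /= => nx.
  have [i hi] := dw' x _ Sx nx.
  exists p, i => j; apply: le_trans ps; apply: ltW; apply: (hi (Sw_w i)); exact: Sv_v.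
move=> [p [i Fi]].
have Fle y : Sv y -> F (w i) y <= t - p.+1%:R^-1.
  move=> Sy; rewrite leNgt; apply/negP => Fgt.
  have [U [V [nU nV UV]]] := cvgF (Sw_w i) Sy (open_nbhs_nbhs (conj (@open_gt R _) Fgt)).
  have [j Vj] := dv' y V Sy nV.
  have := UV (w i) (v j) (nbhs_singleton nU) Vj (Sw_w i) (Sv_v j).
  by rewrite /= ltNge Fi.
have sup_le : sup [set F (w i) y | y in Sv] <= t - p.+1%:R^-1.
  apply: ge_sup; first by exists (F (w i) (v 0%N)); exists (v 0%N).
  by move=> _ [y Sy <-]; exact: Fle.
apply: (@le_lt_trans _ _ (t - p.+1%:R^-1)); last first.
  by rewrite ltrBlDr ltrDl invr_gt0 ltr0n.
apply: le_trans sup_le; apply: ge_inf; last by exists (w i).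
(* The set of sups is bounded below, so [inf] is a genuine infimum. *)
exists (- M) => _ [x Sx <-].
apply: (@le_trans _ _ (F x (v 0%N))); last first.
  by apply: ub_le_sup; [exact: ubF|exists (v 0%N)].
by have := FM _ _ Sx (Sv_v 0%N); rewrite ler_norml => /andP[].
Qed.

End minmax_dense.

Section minmax_probability.
Context {R : realType} {X Y : topologicalType} (Sw : set X) (Sv : set Y).
Variables (w : nat -> X) (v : nat -> Y).
Hypothesis cSw : compact Sw.
Hypothesis cSv : compact Sv.
Hypothesis dw : dense_seq_in Sw w.
Hypothesis dv : dense_seq_in Sv v.
Context {d : measure_display} {T : measurableType d} (P : probability T R).

Let measurable_le (F : T -> X -> Y -> R) (u : R) i j :
  measurable_fun setT (fun om => F om (w i) (v j)) ->
  measurable [set om | F om (w i) (v j) <= u].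
Proof.
move=> mF; rewrite (_ : mkset _ = setT `&` (fun om => F om (w i) (v j)) @^-1` `]-oo, u]%classic).
  by apply: mF => //; exact: measurable_itv.
by rewrite setTI; apply/seteqP; split=> om /=; rewrite in_itv.
Qed.

Lemma measurable_minmax_lt (F : T -> X -> Y -> R) (t : R) :
  (forall om, {within Sw `*` Sv, continuous (fun xy => F om xy.1 xy.2)}) ->
  (forall i j, measurable_fun setT (fun om => F om (w i) (v j))) ->
  measurable [set om | minmax Sw Sv (F om) < t].
Proof.
move=> cF mF; rewrite (_ : mkset _ = \bigcup_p \bigcup_i \bigcap_j
    [set om | F om (w i) (v j) <= t - p.+1%:R^-1]).
  apply: bigcupT_measurable => p; apply: bigcupT_measurable => i.
  by apply: bigcapT_measurable => j; exact: measurable_le.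
apply/seteqP; split=> om /=.
  move=> /(minmax_ltP cSw cSv dw dv (cF om)) [p [i h]].
  by exists p => //; exists i => // j _; exact: h.
move=> [p _ [i _ h]]; apply/(minmax_ltP cSw cSv dw dv (cF om)).
by exists p, i => j; exact: (h j Logic.I).
Qed.

(** Two monotone limits: the rows increase to the event for [F], and for a fixed number of rows the
    columns decrease to an event contained in the one for [f]. *)
Lemma minmax_prob_le (F f : T -> X -> Y -> R) (c : R) (t : R) : 0 <= c ->
  (forall om, {within Sw `*` Sv, continuous (fun xy => F om xy.1 xy.2)}) ->
  (forall om, {within Sw `*` Sv, continuous (fun xy => f om xy.1 xy.2)}) ->
  (forall i j, measurable_fun setT (fun om => F om (w i) (v j))) ->
  (forall i j, measurable_fun setT (fun om => f om (w i) (v j))) ->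
  (forall (q N : nat) (s s' : R), s < s' ->
    (P [set om | exists i : 'I_q, forall j : 'I_N, (F om (w i) (v j) < s)%R] <=
     c%:E * P [set om | exists i : 'I_q, forall j : 'I_N, (f om (w i) (v j) < s')%R])%E) ->
  (P [set om | (minmax Sw Sv (F om) < t)%R] <=
   c%:E * P [set om | (minmax Sw Sv (f om) < t)%R])%E.
Proof.
move=> c0 cF cf mF mf cmp.
(* One index controls both the number of rows and the margin, which makes the sequence
   increasing. *)
pose C (q : nat) := \bigcup_(i in [set: 'I_q.+1]) \bigcap_j
  [set om | F om (w i) (v j) <= t - q.+1%:R^-1].
have mC q : measurable (C q).
  by apply: fin_bigcup_measurable => // i _; apply: bigcapT_measurable => j; exact: measurable_le.
have CU : [set om | minmax Sw Sv (F om) < t] = \bigcup_q C q.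
  apply/seteqP; split=> om /=.
    move=> /(minmax_ltP cSw cSv dw dv (cF om)) [p [i h]].
    exists (maxn p i) => //; have ip : (i < (maxn p i).+1)%N by rewrite ltnS leq_maxr.
    exists (Ordinal ip) => // j _ /=; apply: le_trans (h j) _.
    by rewrite lerD2l lerN2 lef_pV2 ?posrE ?ltr0n// ler_nat ltnS leq_maxl.
  move=> [q _ [i _ h]]; apply/(minmax_ltP cSw cSv dw dv (cF om)).
  by exists q, i => j; exact: (h j Logic.I).
have ndC : nondecreasing_seq C.
  move=> q q' qq'; apply/subsetPset => om [i _ h].
  exists (widen_ord (qq' : (q.+1 <= q'.+1)%N) i) => // j _ /=; apply: le_trans (h j Logic.I) _.
  by rewrite lerD2l lerN2 lef_pV2 ?posrE ?ltr0n// ler_nat ltnS.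
have cvgC : P (C q) @[q --> \oo] --> P (\bigcup_q C q).
  by apply: (nondecreasing_cvg_mu mC) => //; exact: bigcupT_measurable.
rewrite CU -(cvg_lim (@ereal_hausdorff R) cvgC).
apply: lime_le; first by apply/cvg_ex; eexists; exact: cvgC.
apply: nearW => q.
(* A third of the margin makes the bound for [F] strict, a third is the gap [s < s'] required by
   [cmp], and the last third remains as margin for [f]. *)
pose e : R := q.+1%:R^-1 / 3.
have e0 : 0 < e by rewrite divr_gt0// invr_gt0 ltr0n.
have eE : q.+1%:R^-1 = 3 * e :> R by rewrite /e; field.
pose A N := [set om | exists i : 'I_q.+1, forall j : 'I_N, F om (w i) (v j) < t - 2 * e].
pose B N := [set om | exists i : 'I_q.+1, forall j : 'I_N, f om (w i) (v j) < t - e].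
have mB N : measurable (B N).
  by apply: (measurable_minmax_event (Z := fun (m : 'I_q.+1 * 'I_N) om => f om (w m.1) (v m.2))).
have mA N : measurable (A N).
  by apply: (measurable_minmax_event (Z := fun (m : 'I_q.+1 * 'I_N) om => F om (w m.1) (v m.2))).
have CB N : (P (C q) <= c%:E * P (B N))%E.
  apply: (@le_trans _ _ (P (A N))); last by apply: cmp; lra.
  apply: le_measure; rewrite ?inE// => om [i _ h].
  exists i => j; apply: le_lt_trans (h j Logic.I) _; rewrite eE; lra.
have niB : nonincreasing_seq B.
  move=> N N' NN'; apply/subsetPset => om [i h]; exists i => j.
  exact: (h (widen_ord NN' j)).
have cvgB : P (B N) @[N --> \oo] --> P (\bigcap_N B N).
  apply: (nonincreasing_cvg_mu _ mB) => //; last exact: bigcapT_measurable.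
  by rewrite (le_lt_trans (probability_le1 _ (mB 0%N)))// ltry.
have BI : \bigcap_N B N `<=` [set om | minmax Sw Sv (f om) < t].
  (* The good row could vary with [N]. If each of the finitely many rows failed at some column, a
     value of [N] beyond all these columns would contradict [hB]. *)
  move=> om hB; have [i hi] : exists i : 'I_q.+1, forall j, f om (w i) (v j) < t - e.
    apply: contrapT => /forallNP hN.
    have J (i : 'I_q.+1) : {j | ~ f om (w i) (v j) < t - e}.
      by apply: cid; apply/existsNP; exact: hN.
    have [i hi] := hB (\max_(i < q.+1) sval (J i)).+1 Logic.I.
    have ji : (sval (J i) < (\max_(i < q.+1) sval (J i)).+1)%N by rewrite ltnS leq_bigmax.
    exact: (svalP (J i)) (hi (Ordinal ji)).
  apply/(minmax_ltP cSw cSv dw dv (cf om)); exists (Num.truncn e^-1), i => j.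
  apply: le_trans (ltW (hi j)) _; rewrite lerD2l lerN2.
  rewrite -[leRHS]invrK lef_pV2 ?posrE ?ltr0n ?invr_gt0//.
  by rewrite ltW// truncnS_gt.
apply: (@le_trans _ _ (c%:E * P (\bigcap_N B N)))%E.
  have cvgcB : (c%:E * P (B N))%E @[N --> \oo] --> (c%:E * P (\bigcap_N B N))%E.
    by apply: cvgeZl => //.
  rewrite -(cvg_lim (@ereal_hausdorff R) cvgcB); apply: lime_ge.
    by apply/cvg_ex; eexists; exact: cvgcB.
  by apply: nearW => N; exact: CB.
apply: lee_wpmul2l; first by rewrite lee_fin.
apply: le_measure => //; rewrite inE; first exact: bigcapT_measurable.
exact: measurable_minmax_lt.
Qed.

End minmax_probability.

(** * Continuity of the two processes and conclusion *)

Section euclidean_continuity.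
Context {R : realType} {Z : topologicalType}.

Lemma continuous_sumr (J : finType) (f : J -> Z -> R) :
  (forall j, continuous (f j)) -> continuous (fun z => \sum_j f j z).
Proof.
move=> cf z.
suff aux (s : seq J) : \sum_(j <- s) f j y @[y --> z] --> \sum_(j <- s) f j z by exact: aux.
elim: s => [|j s IH].
  by rewrite big_nil; under eq_fun do rewrite big_nil; exact: cvg_cst.
rewrite big_cons; under eq_fun do rewrite big_cons.
by apply: (@cvgD _ R^o) IH; exact: cf.
Qed.

Lemma continuous_entry (m : nat) (f : Z -> 'rV[R]_m) j :
  continuous f -> continuous (fun z => f z ord0 j).
Proof.
move=> cf z; apply: (cvg_comp f (fun x : 'rV[R]_m => x ord0 j) (cf z)).
exact: coord_continuous.
Qed.

Lemma continuous_enorm (m : nat) (f : Z -> 'rV[R]_m) :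
  continuous f -> continuous (fun z => enorm (f z)).
Proof.
move=> cf z; apply: (cvg_comp (fun z => \sum_(i < m) f z ord0 i ^+ 2) Num.sqrt);
  last exact: sqrt_continuous.
move: z; apply: continuous_sumr => i z; under eq_fun do rewrite expr2.
by apply: cvgM; exact: continuous_entry.
Qed.

Lemma continuous_dotv (m : nat) (x : 'rV[R]_m) (f : Z -> 'rV[R]_m) :
  continuous f -> continuous (fun z => dotv x (f z)).
Proof.
move=> cf; under eq_fun do rewrite dotvE.
by apply: continuous_sumr => i z; apply: cvgM; [exact: cvg_cst|exact: continuous_entry].
Qed.

Lemma continuous_bilin (m p : nat) (M : 'M[R]_(m, p)) (f : Z -> 'rV[R]_m) (g : Z -> 'rV[R]_p) :
  continuous f -> continuous g -> continuous (fun z => bilin (f z) M (g z)).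
Proof.
move=> cf cg; under eq_fun do rewrite bilinE.
apply: continuous_sumr => i; apply: continuous_sumr => j z.
apply: cvgM; last exact: cvg_cst.
by apply: cvgM; exact: continuous_entry.
Qed.

End euclidean_continuity.

Section process_continuity.
Context {R : realType} {k d : nat} {n : 'I_k -> nat}.
Local Notation V := (prod_topology (fun l : 'I_k => 'rV[R]_(n l))).
Variables (alpha : 'I_k -> 'rV[R]_d -> 'rV[R]_d)
  (beta : forall l : 'I_k, 'rV[R]_(n l) -> 'rV[R]_(n l)).
Hypothesis halpha : forall l, continuous (alpha l).
Hypothesis hbeta : forall l, continuous (@beta l).

Let cont_alpha l : continuous (fun xy : 'rV[R]_d * V => alpha l xy.1).
Proof. by move=> xy; apply: (cvg_comp fst (alpha l)); [exact: cvg_fst|exact: halpha]. Qed.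

Let cont_beta l : continuous (fun xy : 'rV[R]_d * V => beta (xy.2 l)).
Proof.
move=> xy.
have cl : (fun xy : 'rV[R]_d * V => xy.2 l) y @[y --> xy] --> xy.2 l.
  apply: (cvg_comp snd (fun v : V => v l)); first exact: cvg_snd.
  exact: (@proj_continuous 'I_k (fun l => 'rV[R]_(n l)) l).
by apply: (cvg_comp _ (@beta l) cl); exact: hbeta.
Qed.

Lemma continuous_bilin_process (G : forall l, 'M[R]_(n l, d)) :
  continuous (fun xy : 'rV[R]_d * V =>
    \sum_(l < k) bilin (beta (xy.2 l)) (G l) (alpha l xy.1)).
Proof. by apply: continuous_sumr => l; exact: continuous_bilin. Qed.

Lemma continuous_dotv_process (g : 'I_k -> 'rV[R]_d) (h : forall l, 'rV[R]_(n l)) :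
  continuous (fun xy : 'rV[R]_d * V =>
    \sum_(l < k) (enorm (beta (xy.2 l)) * dotv (g l) (alpha l xy.1)
                  + enorm (alpha l xy.1) * dotv (h l) (beta (xy.2 l)))).
Proof.
apply: continuous_sumr => l xy.
have cb : continuous (fun xy : 'rV[R]_d * V => enorm (beta (xy.2 l))).
  exact: continuous_enorm.
have ca : continuous (fun xy : 'rV[R]_d * V => enorm (alpha l xy.1)).
  exact: continuous_enorm.
have cg : continuous (fun xy : 'rV[R]_d * V => dotv (g l) (alpha l xy.1)).
  exact: continuous_dotv.
have ch : continuous (fun xy : 'rV[R]_d * V => dotv (h l) (beta (xy.2 l))).
  exact: continuous_dotv.
by apply: (@cvgD _ R^o); [apply: cvgM; [exact: cb|exact: cg]|apply: cvgM; [exact: ca|exact: ch]].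
Qed.

End process_continuity.

Unset Implicit Arguments.

Theorem theorem4p2 (R : realType) (k d : nat) (n : 'I_k -> nat)
  (hk : (0 < k)%N) (hd : (0 < d)%N) (hn : forall l, (0 < n l)%N)
  (Sw : set 'rV[R]_d) (Sv : forall l : 'I_k, set 'rV[R]_(n l))
  (hSw : compact Sw) (cSw : convex_set Sw) (neSw : Sw !=set0)
  (hSv : forall l, compact (Sv l)) (cSv : forall l, convex_set (Sv l))
  (neSv : forall l, Sv l !=set0)
  (psi : 'rV[R]_d * prod_topology (fun l : 'I_k => 'rV[R]_(n l)) -> R)
  (hpsi : {within (Sw `*` [set v : prod_topology (fun l : 'I_k => 'rV[R]_(n l)) | forall l, Sv l (v l)]) : set ('rV[R]_d * prod_topology (fun l : 'I_k => 'rV[R]_(n l))), continuous psi})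
  (alpha : 'I_k -> 'rV[R]_d -> 'rV[R]_d)
  (beta : forall l : 'I_k, 'rV[R]_(n l) -> 'rV[R]_(n l))
  (halpha : forall l, continuous (alpha l))
  (hbeta : forall l, continuous (beta l))
  (dT : measure_display) (T : measurableType dT) (P : probability T R)
  (G : forall l : 'I_k, T -> 'M[R]_(n l, d))
  (g : 'I_k -> T -> 'rV[R]_d)
  (h : forall l : 'I_k, T -> 'rV[R]_(n l))
  (hG : iid_std_normal P (gentries G g h))
  (t : R) :
  let SvP := [set v : forall l : 'I_k, 'rV[R]_(n l) | forall l, Sv l (v l)] in
  let Phi (GG : forall l : 'I_k, 'M[R]_(n l, d)) :=
    minmax Sw SvP (fun w v =>
      \sum_(l < k) bilin (beta l (v l)) (GG l) (alpha l w) + psi (w, v)) in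
  let phi (gg : 'I_k -> 'rV[R]_d) (hh : forall l : 'I_k, 'rV[R]_(n l)) :=
    minmax Sw SvP (fun w v =>
      \sum_(l < k) (enorm (beta l (v l)) * dotv (gg l) (alpha l w)
                    + enorm (alpha l w) * dotv (hh l) (beta l (v l)))
      + psi (w, v)) in
  (P [set om | (Phi (fun l => G l om) < t)%R]
   <= ((2 : R) ^+ k)%:E
      * P [set om | (phi (fun l => g l om) (fun l => h l om) < t)%R])%E.
Proof.
cbv zeta.
(* The index set of the statement is a plain set of dependent functions; reading it in the product
   topology makes Tychonoff's theorem and the dense sequences available. *)
pose V := prod_topology (fun l : 'I_k => 'rV[R]_(n l)).
pose SvV : set V := [set v : V | forall l, Sv l (v l)].
have cSvV : compact SvV by exact: tychonoff.
have [w dw] := exists_dense_seq_rV neSw.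
have [v dv] := exists_dense_seq_prod neSv.
have cont_add (f : 'rV[R]_d * V -> R) : continuous f ->
    {within Sw `*` SvV, continuous (fun xy => f xy + psi (xy.1, xy.2))}.
  move=> cf; have -> : (fun xy => f xy + psi (xy.1, xy.2)) = (fun xy => f xy + psi xy).
    by apply/funext => -[].
  move=> xy; apply: (@cvgD _ R^o); last exact: hpsi.
  exact: (continuous_subspaceT cf).
apply: (minmax_prob_le hSw cSvV dw dv
  (F := fun om (x : 'rV[R]_d) (y : V) =>
    \sum_(l < k) bilin (beta l (y l)) (G l om) (alpha l x) + psi (x, y))
  (f := fun om (x : 'rV[R]_d) (y : V) =>
    \sum_(l < k) (enorm (beta l (y l)) * dotv (g l om) (alpha l x)
                    + enorm (alpha l x) * dotv (h l om) (beta l (y l))) + psi (x, y))).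
- by rewrite exprn_ge0.
- by move=> om; apply: cont_add; exact: continuous_bilin_process.
- by move=> om; apply: cont_add; exact: continuous_dotv_process.
- move=> i j; apply: measurable_funD; last exact: measurable_cst.
  exact: (measurable_bilin_sum hG (fun l => beta l (v j l)) (fun l => alpha l (w i))).
- move=> i j; apply: measurable_funD; last exact: measurable_cst.
  exact: (measurable_dotv_sum hG (fun l => beta l (v j l)) (fun l => alpha l (w i))).
(* Initial segments of the two dense sequences are the finite index sets. *)
- move=> q N s s' ss'.
  exact: (finite_comparison hG (fun (i : 'I_q) l => alpha l (w i))
    (fun (j : 'I_N) l => beta l (v j l)) (fun m => psi (w m.1, v m.2)) ss').
Qed.
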